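(* Let $K_3$ be the virtual knot that is the closure of the virtual braid $\rho_1\sigma_1^{-2}\rho_1\sigma_1\in VB_2$ (the knot $3.7$ of Green's table), and let $G(K_3)=G_A(K_3)$ be its group, with generators $x_1,x_2,y$. Then: (1) The quotient $G(K_3)/\langle y^2\rangle^{G(K_3)}$ of $G(K_3)$ by the normal closure of $y^2$ in $G(K_3)$ is isomorphic to $$\langle x,z\mid z^3=1,\ z^{x}=z^{-1}\rangle\ast\mathbb{Z}_2.$$ In particular, it contains a subgroup isomorphic to the free product $\mathbb{Z}_3\ast\mathbb{Z}_2$. (2) $G(K_3)/\gamma_4G(K_3)\cong F_2/\gamma_4F_2$, $\ \gamma_4G(K_3)/\gamma_5G(K_3)\cong\mathbb{Z}^2\times\mathbb{Z}_4$, and $G(K_3)/\gamma_5G(K_3)\not\cong F_2/\gamma_5F_2$, where $F_2$ is the free group of rank 2.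
   Context: Conjugation: $x^{y}=y^{-1}xy$ and $x^{-y}=(x^{-1})^{y}$. Lower central series: $\gamma_1(G)=G$, $\gamma_{i+1}(G)=[\gamma_i(G),G]$. $\mathbb{Z}_m$ is the cyclic group of order $m$. $VB_2$ is generated by $\sigma_1,\rho_1$ with the relation $\rho_1^2=1$. The representation $\varphi_A:VB_2\to\operatorname{Aut}(\langle x_1,x_2,y\rangle)$ (automorphisms of the free group of rank 3) is: $\varphi_A(\sigma_1): x_1\mapsto x_1x_2x_1^{-1},\ x_2\mapsto x_1,\ y\mapsto y$; $\varphi_A(\rho_1): x_1\mapsto x_2^{y^{-1}},\ x_2\mapsto x_1^{y},\ y\mapsto y$. Automorphisms act on the right (in a braid word the automorphism of the leftmost letter is applied first). For a virtual link $K$ that is the closure of $\beta\in VB_2$, $G_A(K)=\langle x_1,x_2,y\mid x_i=\varphi_A(\beta)(x_i),\ i=1,2\rangle$. Explicitly, for $\beta=\rho_1\sigma_1^{-2}\rho_1\sigma_1$, $G(K_3)$ has generators $x_1,x_2,y$ and relations $$x_1=(x_1x_2x_1^{-1})^{-1}\,x_1^{-y^{-2}}\,(x_1x_2x_1^{-1})\,x_1^{y^{-2}}\,(x_1x_2x_1^{-1}),\qquad x_2=(x_1x_2x_1^{-1})^{-y^{2}}\,x_1\,(x_1x_2x_1^{-1})^{y^{2}}.$$ *)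

(* Defs.v *)
From HB Require Import structures.
From mathcomp Require Import all_boot all_algebra.
From mathcomp Require Import boolp classical_sets.

Set Implicit Arguments.
Unset Strict Implicit.
Unset Printing Implicit Defensive.

Local Open Scope quotient_scope.
Local Open Scope classical_set_scope.
Local Open Scope group_scope.

(* The carriers of the groups below are infinite types, so everything is
   built on [groupType] and [groupClosed] (subgroups) of mathcomp's monoid.v,
   not on finite groups.  Subgroups are boolean predicates, which loses nothing
   classically; conjugation is x ^ y = y^-1 * (x * y). *)

Definition isomorphic (G H : groupType) : Prop :=
  exists f : {multiplicative G -> H}, bijective f.

Section SubgroupType.
Variables (G : groupType) (H : groupClosed G).

Record subgroup_type : Type :=
  Subgroup { subgroup_val : G; subgroup_valP : subgroup_val \in H }.

HB.instance Definition _ := [isSub for subgroup_val].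
HB.instance Definition _ := [Choice of subgroup_type by <:].

Lemma subgroup_group_closed : group_closed [pred x | x \in H].
Proof. by split=> [|x y xH yH]; rewrite !inE ?gpred1 // gpredF. Qed.

HB.instance Definition _ :=
  SubChoice_isSubGroup.Build G [pred x | x \in H] subgroup_type
    subgroup_group_closed.
End SubgroupType.

HB.mixin Record isConjClosed (G : groupType) (S : {pred G}) := {
  gpred_conj : forall x y : G, x \in S -> x ^ y \in S
}.

#[short(type="normalSubgroup")]
HB.structure Definition NormalSubgroup (G : groupType) :=
  {S of isConjClosed G S & GroupClosed G S}.

Section Closures.
Variables (G : groupType) (A : set G).

Definition gen : {pred G} :=
  [pred x | `[< forall H : groupClosed G, A `<=` [set` H] -> x \in H >]].

Lemma gen1 : 1 \in gen.
Proof. by apply/asboolP=> H _; exact: gpred1. Qed.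
Lemma genM : mulg_closed gen.
Proof.
move=> x y /asboolP xA /asboolP yA; apply/asboolP=> H sAH.
by rewrite gpredM ?xA ?yA.
Qed.
Lemma genV : invg_closed gen.
Proof.
by move=> x /asboolP xA; apply/asboolP=> H sAH; apply: gpredVr; exact: xA.
Qed.
HB.instance Definition _ := isMulClosed.Build G gen genM.
HB.instance Definition _ := isMul1Closed.Build G gen gen1.
HB.instance Definition _ := isInvClosed.Build G gen genV.

Lemma mem_gen x : A x -> x \in gen.
Proof. by move=> Ax; apply/asboolP => H; apply. Qed.

Lemma gen_min (H : groupClosed G) :
  A `<=` [set` H] -> {subset gen <= H}.
Proof. by move=> sAH x /asboolP; apply. Qed.

Definition normal_closure : {pred G} :=
  [pred x | `[< forall N : normalSubgroup G, A `<=` [set` N] -> x \in N >]].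

Lemma normal_closure1 : 1 \in normal_closure.
Proof. by apply/asboolP=> H _; exact: gpred1. Qed.
Lemma normal_closureM : mulg_closed normal_closure.
Proof.
move=> x y /asboolP xA /asboolP yA; apply/asboolP=> H sAH.
by rewrite gpredM ?xA ?yA.
Qed.
Lemma normal_closureV : invg_closed normal_closure.
Proof.
by move=> x /asboolP xA; apply/asboolP=> H sAH; apply: gpredVr; exact: xA.
Qed.
Lemma normal_closureJ x y : x \in normal_closure -> x ^ y \in normal_closure.
Proof.
by move=> /asboolP xA; apply/asboolP=> H sAH; apply: gpred_conj; exact: xA.
Qed.
HB.instance Definition _ := isMulClosed.Build G normal_closure normal_closureM.
HB.instance Definition _ := isMul1Closed.Build G normal_closure normal_closure1.
HB.instance Definition _ := isInvClosed.Build G normal_closure normal_closureV.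
HB.instance Definition _ := isConjClosed.Build G normal_closure normal_closureJ.

Lemma mem_normal_closure x : A x -> x \in normal_closure.
Proof. by move=> Ax; apply/asboolP => H; apply. Qed.

Lemma normal_closure_min (N : normalSubgroup G) :
  A `<=` [set` N] -> {subset normal_closure <= N}.
Proof. by move=> sAH x /asboolP; apply. Qed.

End Closures.

Section Quotient.
Variables (G : groupType) (N : normalSubgroup G).

Definition quot_rel (x y : G) : bool := x^-1 * y \in N.

Lemma quot_rel_refl : reflexive quot_rel.
Proof. by move=> x; rewrite /quot_rel mulVg gpred1. Qed.
Lemma quot_rel_sym : symmetric quot_rel.
Proof. by move=> x y; rewrite /quot_rel -gpredV invgM invgK. Qed.
Lemma quot_rel_trans : transitive quot_rel.
Proof.
move=> y x z xy yz; rewrite /quot_rel.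
by rewrite -(mulVKg y z) mulgA gpredM.
Qed.

Canonical quot_equiv :=
  EquivRel quot_rel quot_rel_refl quot_rel_sym quot_rel_trans.

Definition quot : Type := {eq_quot quot_equiv}.
HB.instance Definition _ := Choice.on quot.
HB.instance Definition _ := Quotient.on quot.

Definition quot_proj (x : G) : quot := \pi_quot x.

Lemma quot_projP x y : (quot_proj x = quot_proj y) <-> (x^-1 * y \in N).
Proof. by split=> [/eqmodP|?]; [|apply/eqmodP]. Qed.

Lemma quot_reprK (u : quot) : quot_proj (repr u) = u.
Proof. exact: reprK. Qed.

Lemma quot_ind (P : quot -> Prop) : (forall x, P (quot_proj x)) -> forall u, P u.
Proof. by move=> Px u; rewrite -(quot_reprK u). Qed.

Definition quot_mul (u v : quot) : quot := quot_proj (repr u * repr v).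
Definition quot_inv (u : quot) : quot := quot_proj (repr u)^-1.

Lemma quot_mulE x y : quot_mul (quot_proj x) (quot_proj y) = quot_proj (x * y).
Proof.
apply/quot_projP.
have /quot_projP := quot_reprK (quot_proj x); set x' := repr _ => hx.
have /quot_projP := quot_reprK (quot_proj y); set y' := repr _ => hy.
have -> : (x' * y')^-1 * (x * y) = (x'^-1 * x) ^ y' * (y'^-1 * y).
  by rewrite /conjg invgM !mulgA mulgK.
by rewrite gpredM // gpred_conj.
Qed.

Lemma quot_invE x : quot_inv (quot_proj x) = quot_proj x^-1.
Proof.
apply/quot_projP; rewrite invgK.
have /quot_projP := quot_reprK (quot_proj x); set x' := repr _ => hx.
have -> : x' / x = ((x'^-1 * x) ^ x^-1)^-1.
  by rewrite /conjg invgK mulgK invgM invgK.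
by rewrite gpredV gpred_conj.
Qed.

Lemma quot_mulA : associative quot_mul.
Proof.
elim/quot_ind=> x; elim/quot_ind=> y; elim/quot_ind=> z.
by rewrite !quot_mulE mulgA.
Qed.
Lemma quot_mul1 : left_id (quot_proj 1) quot_mul.
Proof. by elim/quot_ind=> x; rewrite quot_mulE mul1g. Qed.
Lemma quot_mulr1 : right_id (quot_proj 1) quot_mul.
Proof. by elim/quot_ind=> x; rewrite quot_mulE mulg1. Qed.
HB.instance Definition _ := isMonoid.Build quot quot_mulA quot_mul1 quot_mulr1.

HB.instance Definition _ := hasInv.Build quot quot_inv.
Lemma quot_mulV : left_inverse 1 quot_inv quot_mul.
Proof. by elim/quot_ind=> x; rewrite quot_invE quot_mulE mulVg. Qed.
Lemma quot_mulrV : right_inverse 1 quot_inv quot_mul.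
Proof. by elim/quot_ind=> x; rewrite quot_invE quot_mulE mulgV. Qed.
HB.instance Definition _ := Monoid_isGroup.Build quot quot_mulV quot_mulrV.

Lemma quot_proj_morphism : monoid_morphism quot_proj.
Proof. by split=> // x y; rewrite -quot_mulE. Qed.
HB.instance Definition _ := isUMagmaMorphism.Build G quot quot_proj
  quot_proj_morphism.

Lemma quot_proj_eq1 x : (quot_proj x = 1) <-> (x \in N).
Proof.
change (quot_proj x = quot_proj 1 <-> x \in N); split=> [/quot_projP|xN].
  by rewrite mulg1 gpredV.
by apply/quot_projP; rewrite mulg1 gpredV.
Qed.

Section Lift.
Variables (K : groupType) (f : UMagmaMorphism.type G K).
Hypothesis fN : forall x, x \in N -> f x = 1.

Definition quot_lift_fun (u : quot) : K := f (repr u).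

Lemma quot_lift_funE x : quot_lift_fun (quot_proj x) = f x.
Proof.
have /quot_projP /fN := quot_reprK (quot_proj x).
by rewrite gmulfM gmulfV => /mulg1_eq; rewrite invgK.
Qed.

Lemma quot_lift_morphism : monoid_morphism quot_lift_fun.
Proof.
split; first by rewrite (quot_lift_funE 1) gmulf1.
elim/quot_ind=> x; elim/quot_ind=> y.
by rewrite -gmulfM !quot_lift_funE gmulfM.
Qed.

Definition quot_lift : UMagmaMorphism.type quot K :=
  HB.pack quot_lift_fun (isUMagmaMorphism.Build quot K quot_lift_fun
    quot_lift_morphism).

Lemma quot_liftE x : quot_lift (quot_proj x) = f x.
Proof. exact: quot_lift_funE. Qed.
End Lift.

End Quotient.

(** H / N as a quotient of the subgroup H, for N normal in G; this is the
    usual H / N when N is contained in H *)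

Section SubQuotient.
Variables (G : groupType) (H : groupClosed G) (N : normalSubgroup G).

Definition restrict : {pred subgroup_type H} := [pred u | val u \in N].

Lemma restrict1 : 1 \in restrict.
Proof. by rewrite inE val1 gpred1. Qed.
Lemma restrictM : mulg_closed restrict.
Proof. by move=> u v; rewrite !inE valM; exact: gpredM. Qed.
Lemma restrictV : invg_closed restrict.
Proof. by move=> u; rewrite !inE gmulfV gpredV. Qed.
Lemma restrictJ u v : u \in restrict -> u ^ v \in restrict.
Proof. by rewrite !inE gmulfJ; exact: gpred_conj. Qed.
HB.instance Definition _ := isMulClosed.Build _ restrict restrictM.
HB.instance Definition _ := isMul1Closed.Build _ restrict restrict1.
HB.instance Definition _ := isInvClosed.Build _ restrict restrictV.
HB.instance Definition _ := isConjClosed.Build _ restrict restrictJ.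

Definition sub_quot : groupType := quot restrict.
End SubQuotient.

(** Lower central series: gamma_ 1 = G and gamma_ (n + 1) = [gamma_ n, G];
    gamma_ 0 is also G *)

Section LowerCentral.
Variable G : groupType.

Definition comm_with (S : {pred G}) : {pred G} :=
  gen [set z | exists x y, x \in S /\ z = [~ x, y]].

Definition lower_central (n : nat) : {pred G} :=
  iter n.-1 comm_with predT.

Lemma comm_withJ (S : {pred G}) :
  (forall x y, x \in S -> x ^ y \in S) ->
  forall x y, x \in comm_with S -> x ^ y \in comm_with S.
Proof.
move=> SJ x y xS.
pose J : {pred G} := [pred z | z ^ y \in comm_with S].
have J1 : 1 \in J by change (1 ^ y \in comm_with S); rewrite conj1g; exact: gen1.
have JM : mulg_closed J.
  move=> u v; change (u ^ y \in comm_with S -> v ^ y \in comm_with S ->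
    (u * v) ^ y \in comm_with S).
  by rewrite conjMg; exact: genM.
have JV : invg_closed J.
  move=> u; change (u ^ y \in comm_with S -> u^-1 ^ y \in comm_with S).
  by rewrite conjVg; exact: genV.
pose J' : groupClosed G := HB.pack J (isMulClosed.Build G J JM)
  (isMul1Closed.Build G J J1) (isInvClosed.Build G J JV).
apply: (@gen_min _ _ J') xS => _ /= [u [v [uS ->]]].
change ([~ u, v] ^ y \in comm_with S); rewrite conjRg; apply: mem_gen.
by exists (u ^ y), (v ^ y); split=> //; exact: SJ.
Qed.

Lemma lower_centralP n :
  [/\ 1 \in lower_central n, mulg_closed (lower_central n),
      invg_closed (lower_central n)
    & forall x y, x \in lower_central n -> x ^ y \in lower_central n].
Proof.
rewrite /lower_central; elim: n.-1 => [|m [_ _ _ IH]] //.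
by split; [exact: gen1 | exact: genM | exact: genV | exact: comm_withJ].
Qed.

HB.instance Definition _ n := isMulClosed.Build G (lower_central n)
  (let: And4 _ h _ _ := lower_centralP n in h).
HB.instance Definition _ n := isMul1Closed.Build G (lower_central n)
  (let: And4 h _ _ _ := lower_centralP n in h).
HB.instance Definition _ n := isInvClosed.Build G (lower_central n)
  (let: And4 _ _ h _ := lower_centralP n in h).
HB.instance Definition _ n := isConjClosed.Build G (lower_central n)
  (let: And4 _ _ _ h := lower_centralP n in h).
End LowerCentral.
Arguments lower_central G n : clear implicits.

(** Free groups: words over T and formal inverses, modulo cancellation; the
    letter (b, t) stands for t^-1 if b is true and for t otherwise *)

Section FreeGroup.
Variable T : choiceType.
Local Notation word := (seq (bool * T)).

Inductive word_equiv : word -> word -> Prop :=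
| word_refl u : word_equiv u u
| word_sym u v : word_equiv u v -> word_equiv v u
| word_trans v u w : word_equiv u v -> word_equiv v w -> word_equiv u w
| word_cancel u b t v : word_equiv (u ++ [:: (b, t), (~~ b, t) & v]) (u ++ v).

Definition free_rel (u v : word) : bool := `[< word_equiv u v >].

Lemma free_rel_refl : reflexive free_rel.
Proof. by move=> u; apply/asboolP/word_refl. Qed.
Lemma free_rel_sym : symmetric free_rel.
Proof. by move=> u v; apply/asboolP/asboolP; exact: word_sym. Qed.
Lemma free_rel_trans : transitive free_rel.
Proof.
move=> v u w /asboolP uv /asboolP vw; apply/asboolP; exact: word_trans uv vw.
Qed.

Canonical free_equiv :=
  EquivRel free_rel free_rel_refl free_rel_sym free_rel_trans.

Definition free : Type := {eq_quot free_equiv}.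
HB.instance Definition _ := Choice.on free.
HB.instance Definition _ := Quotient.on free.

Definition free_class (w : word) : free := \pi_free w.

Lemma free_classP u v : (free_class u = free_class v) <-> word_equiv u v.
Proof.
by split=> [/eqmodP/asboolP|uv] //; apply/eqmodP/asboolP.
Qed.

Lemma free_reprK (x : free) : free_class (repr x) = x.
Proof. exact: reprK. Qed.

Lemma free_ind (P : free -> Prop) : (forall w, P (free_class w)) -> forall x, P x.
Proof. by move=> Pw x; rewrite -(free_reprK x). Qed.

Definition word_inv (w : word) : word := rev [seq (~~ a.1, a.2) | a <- w].

Definition free_mul (x y : free) : free := free_class (repr x ++ repr y).
Definition free_inv (x : free) : free := free_class (word_inv (repr x)).

Lemma word_equiv_cat u u' v v' :
  word_equiv u u' -> word_equiv v v' -> word_equiv (u ++ v) (u' ++ v').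
Proof.
move=> uu' vv'; apply: (@word_trans (u' ++ v)).
  elim: uu' => {u u'} [u|u u' _ IH|w u u' _ IH1 _ IH2|u b t u'].
  - exact: word_refl.
  - exact: word_sym.
  - exact: word_trans IH1 IH2.
  - by rewrite -!catA; exact: word_cancel.
elim: vv' => {v v'} [v|v v' _ IH|w v v' _ IH1 _ IH2|v b t v'].
- exact: word_refl.
- exact: word_sym.
- exact: word_trans IH1 IH2.
- by rewrite !catA; exact: word_cancel.
Qed.

Lemma word_inv_cat u v : word_inv (u ++ v) = word_inv v ++ word_inv u.
Proof. by rewrite /word_inv map_cat rev_cat. Qed.

Lemma word_invK : involutive word_inv.
Proof.
move=> w; rewrite /word_inv map_rev revK -map_comp.
by rewrite -[RHS]map_id; apply: eq_map => -[b t] /=; rewrite negbK.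
Qed.

Lemma word_equiv_inv u v : word_equiv u v -> word_equiv (word_inv u) (word_inv v).
Proof.
elim=> {u v} [u|u v _ IH|w u v _ IH1 _ IH2|u b t v].
- exact: word_refl.
- exact: word_sym.
- exact: word_trans IH1 IH2.
rewrite -cat1s -(cat1s (~~ b, t)) !word_inv_cat /= -!catA /= negbK.
exact: word_cancel.
Qed.

Lemma word_invV w : word_equiv (word_inv w ++ w) [::].
Proof.
elim: w => [|[b t] w IH]; first exact: word_refl.
rewrite -cat1s word_inv_cat -catA /=; apply: word_trans IH.
by rewrite -{2}[b]negbK; exact: word_cancel.
Qed.

Lemma free_mulE u v : free_mul (free_class u) (free_class v) = free_class (u ++ v).
Proof.
by apply/free_classP/word_equiv_cat; apply/free_classP; rewrite free_reprK.
Qed.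

Lemma free_invE u : free_inv (free_class u) = free_class (word_inv u).
Proof.
by apply/free_classP/word_equiv_inv; apply/free_classP; rewrite free_reprK.
Qed.

Lemma free_mulA : associative free_mul.
Proof.
elim/free_ind=> u; elim/free_ind=> v; elim/free_ind=> w.
by rewrite !free_mulE catA.
Qed.
Lemma free_mul1 : left_id (free_class [::]) free_mul.
Proof. by elim/free_ind=> u; rewrite free_mulE. Qed.
Lemma free_mulr1 : right_id (free_class [::]) free_mul.
Proof. by elim/free_ind=> u; rewrite free_mulE cats0. Qed.
HB.instance Definition _ := isMonoid.Build free free_mulA free_mul1 free_mulr1.

HB.instance Definition _ := hasInv.Build free free_inv.
Lemma free_mulV : left_inverse 1 free_inv free_mul.
Proof.
elim/free_ind=> u; rewrite free_invE free_mulE.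
by apply/free_classP; exact: word_invV.
Qed.
Lemma free_mulrV : right_inverse 1 free_inv free_mul.
Proof.
elim/free_ind=> u; rewrite free_invE free_mulE.
by apply/free_classP; rewrite -{1}[u]word_invK; exact: word_invV.
Qed.
HB.instance Definition _ := Monoid_isGroup.Build free free_mulV free_mulrV.

Lemma free_class_nil : free_class [::] = 1. Proof. by []. Qed.
Lemma free_class_cat u v : free_class (u ++ v) = free_class u * free_class v.
Proof. by rewrite -free_mulE. Qed.
Lemma free_class_inv u : free_class (word_inv u) = (free_class u)^-1.
Proof. by rewrite -free_invE. Qed.

Definition free_gen (t : T) : free := free_class [:: (false, t)].

Section Lift.
Variables (G : groupType) (f : T -> G).

Fixpoint word_eval (w : word) : G :=
  if w is (b, t) :: w' then (if b then (f t)^-1 else f t) * word_eval w' else 1.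

Definition free_lift (x : free) : G := word_eval (repr x).

Lemma word_eval_cat u v : word_eval (u ++ v) = word_eval u * word_eval v.
Proof. by elim: u => [|[b t] u IH] /=; rewrite ?mul1g // IH mulgA. Qed.

Lemma word_eval_equiv u v : word_equiv u v -> word_eval u = word_eval v.
Proof.
elim=> {u v} [//|u v _ ->//|w u v _ -> _ ->//|u b t v].
rewrite !word_eval_cat /=; congr (_ * _).
by case: b => /=; rewrite ?mulKg ?mulVKg.
Qed.

Lemma free_lift_class w : free_lift (free_class w) = word_eval w.
Proof.
by apply/word_eval_equiv/free_classP; rewrite free_reprK.
Qed.

Lemma free_lift_morphism : monoid_morphism free_lift.
Proof.
split; first by rewrite -[1]/(free_class [::]) free_lift_class.
elim/free_ind=> u; elim/free_ind=> v.
by rewrite -free_class_cat !free_lift_class word_eval_cat.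
Qed.
HB.instance Definition _ := isUMagmaMorphism.Build free G free_lift
  free_lift_morphism.

Lemma free_liftE t : free_lift (free_gen t) = f t.
Proof. by rewrite free_lift_class /= mulg1. Qed.
End Lift.

Lemma free_hom_ext (G : groupType) (f g : UMagmaMorphism.type free G) :
  (forall t, f (free_gen t) = g (free_gen t)) -> f =1 g.
Proof.
move=> fg; elim/free_ind; elim=> [|[b t] w IH].
  by rewrite free_class_nil !gmulf1.
rewrite -cat1s free_class_cat !gmulfM IH; congr (_ * _).
case: b; last exact: fg.
have -> : free_class [:: (true, t)] = (free_gen t)^-1.
  by rewrite -free_class_inv.
by rewrite !gmulfV fg.
Qed.
End FreeGroup.

(** Groups given by generators and relations: an element (u, v) of R is the
    relation u = v *)

Section Presentation.
Variables (T : choiceType) (R : set (free T * free T)).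

Definition relators : set (free T) := [set p.1 / p.2 | p in R].

Definition presented : groupType := quot (normal_closure relators).

Definition pres_gen (t : T) : presented :=
  quot_proj (normal_closure relators) (free_gen t).

Section Lift.
Variables (G : groupType) (f : T -> G).
Hypothesis fR : forall p, R p -> free_lift f p.1 = free_lift f p.2.

Lemma pres_lift_subproof x :
  x \in normal_closure relators -> free_lift f x = 1.
Proof.
pose K : {pred free T} := [pred x | free_lift f x == 1].
have KE x' : (x' \in K) = (free_lift f x' == 1) by [].
have K1 : 1 \in K by rewrite KE gmulf1.
have KM : mulg_closed K.
  by move=> u v; rewrite !KE gmulfM /= => /eqP-> /eqP->; rewrite mulg1.
have KV : invg_closed K.
  by move=> u; rewrite !KE gmulfV /= => /eqP->; rewrite invg1.
have KJ u v : u \in K -> u ^ v \in K.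
  by rewrite !KE gmulfJ /= => /eqP->; rewrite conj1g.
pose K' : normalSubgroup (free T) := HB.pack K (isMulClosed.Build _ K KM)
  (isMul1Closed.Build _ K K1) (isInvClosed.Build _ K KV)
  (isConjClosed.Build _ K KJ).
move=> xR; apply/eqP; apply: (@normal_closure_min _ _ K') xR.
move=> _ [p Rp <-]; change (free_lift f (p.1 / p.2) == 1).
by rewrite gmulfF /= fR // divgg.
Qed.

Definition pres_lift : UMagmaMorphism.type presented G :=
  quot_lift pres_lift_subproof.

Lemma pres_liftE t : pres_lift (pres_gen t) = f t.
Proof. by rewrite [LHS]quot_liftE /= free_liftE. Qed.
End Lift.

Lemma pres_hom_ext (G : groupType) (f g : UMagmaMorphism.type presented G) :
  (forall t, f (pres_gen t) = g (pres_gen t)) -> f =1 g.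
Proof.
move=> fg; elim/quot_ind=> x.
exact: (@free_hom_ext _ _ (f \o quot_proj _) (g \o quot_proj _)).
Qed.

Lemma pres_rel p : R p ->
  free_lift pres_gen p.1 = free_lift pres_gen p.2.
Proof.
have liftE : free_lift pres_gen =1 quot_proj (normal_closure relators).
  by apply: free_hom_ext => t /=; rewrite free_liftE.
move=> Rp; rewrite !liftE; apply: divg1_eq; rewrite -gmulfF /=.
by apply/quot_proj_eq1/mem_normal_closure; exists p.
Qed.
End Presentation.

(** The free product of G and H, presented on the elements of both groups by
    the two multiplication tables *)

Section FreeProduct.
Variables G H : groupType.

Definition free_product_rel : set (free (G + H)%type * free (G + H)%type) :=
  [set p | exists x y : G,
     p = (free_gen (inl x) * free_gen (inl y), free_gen (inl (x * y)))] `|`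
  [set p | exists x y : H,
     p = (free_gen (inr x) * free_gen (inr y), free_gen (inr (x * y)))].

Definition free_product : groupType := presented free_product_rel.
End FreeProduct.

(** Automorphism groups, acting on the right: f * g applies f first *)

Section Automorphisms.
Variable G : groupType.

Record aut : Type := Aut {
  aut_fun :> G -> G;
  aut_morph : {morph aut_fun : x y / x * y};
  aut_bij : bijective aut_fun
}.
HB.instance Definition _ := gen_eqMixin aut.
HB.instance Definition _ := gen_choiceMixin aut.

Lemma aut_ext (f g : aut) : f =1 g -> f = g.
Proof.
case: f g => [f fM fB] [g gM gB] /= /funext fg; case: _ / fg in gM gB *.
by congr Aut; exact: Prop_irrelevance.
Qed.

Definition aut_one : aut :=
  @Aut id (fun _ _ => erefl) (Bijective (fun _ => erefl) (fun _ => erefl)).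

Lemma aut_mul_morph (f g : aut) : {morph (g \o f : G -> G) : x y / x * y}.
Proof. by move=> x y /=; rewrite !aut_morph. Qed.

Definition aut_mul (f g : aut) : aut :=
  @Aut (g \o f) (aut_mul_morph f g) (bij_comp (aut_bij g) (aut_bij f)).

Lemma aut_inv_subproof (f : aut) : exists g : aut, cancel f g /\ cancel g f.
Proof.
have [g fK gK] := aut_bij f.
have gM : {morph g : x y / x * y}.
  by move=> x y; apply: (canLR fK); rewrite aut_morph !gK.
by exists (Aut gM (Bijective gK fK)).
Qed.

Definition aut_inv (f : aut) : aut := sval (cid (aut_inv_subproof f)).

Lemma aut_fK (f : aut) : cancel f (aut_inv f).
Proof. by rewrite /aut_inv; case: cid => g []. Qed.
Lemma aut_invK (f : aut) : cancel (aut_inv f) f.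
Proof. by rewrite /aut_inv; case: cid => g []. Qed.

Lemma aut_mulA : associative aut_mul.
Proof. by move=> f g h; exact: aut_ext. Qed.
Lemma aut_mul1 : left_id aut_one aut_mul.
Proof. by move=> f; exact: aut_ext. Qed.
Lemma aut_mulr1 : right_id aut_one aut_mul.
Proof. by move=> f; exact: aut_ext. Qed.
HB.instance Definition _ := isMonoid.Build aut aut_mulA aut_mul1 aut_mulr1.

HB.instance Definition _ := hasInv.Build aut aut_inv.
Lemma aut_mulV : left_inverse 1 aut_inv aut_mul.
Proof. by move=> f; apply: aut_ext => x /=; rewrite aut_invK. Qed.
Lemma aut_mulrV : right_inverse 1 aut_inv aut_mul.
Proof. by move=> f; apply: aut_ext => x /=; rewrite aut_fK. Qed.
HB.instance Definition _ := Monoid_isGroup.Build aut aut_mulV aut_mulrV.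

Lemma aut_mulE (f g : aut) x : (f * g) x = g (f x).
Proof. by []. Qed.
Lemma aut_invE (f : aut) x y : f y = x -> f^-1 x = y.
Proof. by move=> <-; exact: aut_fK. Qed.

Lemma aut_monoid_morphism (f : aut) : monoid_morphism f.
Proof.
split; last exact: aut_morph.
by apply: (mulgI (f 1)); rewrite -aut_morph !mulg1.
Qed.
HB.instance Definition _ (f : aut) := isUMagmaMorphism.Build G G f
  (aut_monoid_morphism f).
End Automorphisms.

Variant vb2_letter := Sigma1 | Rho1.
HB.instance Definition _ := gen_eqMixin vb2_letter.
HB.instance Definition _ := gen_choiceMixin vb2_letter.

Definition VB2 : groupType := presented [set (free_gen Rho1 ^+ 2, 1)].

Definition sigma1 : VB2 := pres_gen _ Sigma1.
Definition rho1 : VB2 := pres_gen _ Rho1.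

Variant xxy_letter := X1 | X2 | Y.
HB.instance Definition _ := gen_eqMixin xxy_letter.
HB.instance Definition _ := gen_choiceMixin xxy_letter.

Definition F3 : groupType := free xxy_letter.

Definition x_1 : F3 := free_gen X1.
Definition x_2 : F3 := free_gen X2.
Definition y_ : F3 := free_gen Y.

Definition sigma1_img (t : xxy_letter) : F3 :=
  match t with X1 => x_1 * x_2 * x_1^-1 | X2 => x_1 | Y => y_ end.

Definition sigma1_inv_img (t : xxy_letter) : F3 :=
  match t with X1 => x_2 | X2 => x_2^-1 * x_1 * x_2 | Y => y_ end.

Definition rho1_img (t : xxy_letter) : F3 :=
  match t with X1 => x_2 ^ y_^-1 | X2 => x_1 ^ y_ | Y => y_ end.

Lemma free_lift_bij (T : choiceType) (f g : T -> free T) :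
  (forall t, free_lift f (g t) = free_gen t) ->
  (forall t, free_lift g (f t) = free_gen t) -> bijective (free_lift f).
Proof.
move=> fg gf; exists (free_lift g).
  apply: (@free_hom_ext _ _ (free_lift g \o free_lift f) idfun) => t /=.
  by rewrite free_liftE.
apply: (@free_hom_ext _ _ (free_lift f \o free_lift g) idfun) => t /=.
by rewrite free_liftE.
Qed.

Lemma sigma1_bij : bijective (free_lift sigma1_img).
Proof.
apply: (@free_lift_bij _ _ sigma1_inv_img) => -[] //=;
  rewrite ?gmulfM ?gmulfV /= !free_liftE //= ?mulgA ?mulVg ?mul1g ?mulgVK //.
by rewrite mulgV mul1g mulgK.
Qed.

Lemma rho1_img_invol t : free_lift rho1_img (rho1_img t) = free_gen t.
Proof.
by case: t => //=; rewrite ?gmulfJ ?gmulfV /= !free_liftE //= ?conjgK ?conjgKV.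
Qed.

Definition phiA_sigma1 : aut F3 :=
  Aut (@gmulfM _ _ (free_lift sigma1_img)) sigma1_bij.
Definition phiA_rho1 : aut F3 :=
  Aut (@gmulfM _ _ (free_lift rho1_img))
    (free_lift_bij rho1_img_invol rho1_img_invol).

Definition phiA_img (s : vb2_letter) : aut F3 :=
  match s with Sigma1 => phiA_sigma1 | Rho1 => phiA_rho1 end.

Lemma phiA_rel p : [set (free_gen Rho1 ^+ 2, 1 : free vb2_letter)] p ->
  free_lift phiA_img p.1 = free_lift phiA_img p.2.
Proof.
move=> ->; rewrite /= gmulfXn /= gmulf1 free_liftE /=.
apply: aut_ext.
apply: (@free_hom_ext _ _ (free_lift rho1_img \o free_lift rho1_img) idfun).
by move=> t /=; rewrite free_liftE rho1_img_invol.
Qed.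

Definition phiA : UMagmaMorphism.type VB2 (aut F3) := pres_lift phiA_rel.

Lemma phiA_sigma1E :
  [/\ phiA sigma1 x_1 = x_1 * x_2 * x_1^-1, phiA sigma1 x_2 = x_1
    & phiA sigma1 y_ = y_].
Proof.
have -> : phiA sigma1 = phiA_sigma1 by exact: pres_liftE.
by split; exact: free_liftE.
Qed.

Lemma phiA_sigma1VE :
  [/\ (phiA sigma1)^-1 x_1 = x_2, (phiA sigma1)^-1 x_2 = x_2^-1 * x_1 * x_2
    & (phiA sigma1)^-1 y_ = y_].
Proof.
have [s1 s2 sy] := phiA_sigma1E.
split; apply: aut_invE => //.
by rewrite !gmulfM gmulfV /= s1 s2 !mulgA mulVg mul1g mulgVK.
Qed.

Lemma phiA_rho1E :
  [/\ phiA rho1 x_1 = x_2 ^ y_^-1, phiA rho1 x_2 = x_1 ^ y_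
    & phiA rho1 y_ = y_].
Proof.
have -> : phiA rho1 = phiA_rho1 by exact: pres_liftE.
by split; exact: free_liftE.
Qed.

(** G_A(K) = < x1, x2, y | x_i = phi_A(b)(x_i) > for K the closure of b; the
    topological closure itself plays no role *)

Definition GA (b : VB2) : groupType :=
  presented [set (x_1, phiA b x_1); (x_2, phiA b x_2)].

(* the closure of beta3 is the virtual knot K_3 *)
Definition beta3 : VB2 := rho1 * sigma1 ^- 2 * rho1 * sigma1.

Definition GK3 : groupType := GA beta3.

Lemma phiA_beta3E : let u := x_1 * x_2 * x_1^-1 in
  phiA beta3 x_1 = u^-1 * x_1^-1 ^ (y_ ^- 2) * u * x_1 ^ (y_ ^- 2) * u /\
  phiA beta3 x_2 = u^-1 ^ (y_ ^+ 2) * x_1 * u ^ (y_ ^+ 2).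
Proof.
have [s1 s2 sy] := phiA_sigma1E.
have [v1 v2 vy] := phiA_sigma1VE.
have [r1 r2 ry] := phiA_rho1E.
have -> : phiA beta3 =
    phiA rho1 * phiA sigma1 ^- 2 * phiA rho1 * phiA sigma1.
  by rewrite /beta3 !gmulfM gmulfXVn.
move=> u; rewrite {}/u !expg2 invgM !aut_mulE r1 r2 /conjg.
rewrite !(gmulfM, gmulfV) /= !(v1, v2, vy).
rewrite !(gmulfM, gmulfV) /= !(v1, v2, vy).
rewrite !(gmulfM, gmulfV) /= !(r1, r2, ry).
rewrite /conjg !(gmulfM, gmulfV) /= !(s1, s2, sy).
by split; rewrite !(invgM, invgK, mulgA) ?(mulgK, mulgVK, mulgV, mul1g).
Qed.

Definition gy : GK3 := pres_gen _ Y.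

Variant xz_letter := X | Z.
HB.instance Definition _ := gen_eqMixin xz_letter.
HB.instance Definition _ := gen_choiceMixin xz_letter.

Definition Gxz : groupType :=
  let x := free_gen X in let z := free_gen Z in
  presented [set (z ^+ 3, 1); (z ^ x, z^-1)].

(* 'Z_m has m elements only for m >= 2; it is used at m = 2, 3, 4 *)
Definition cyc (m : nat) : groupType := Algebra.to_multiplicative 'Z_m.
Definition cyc_inf : groupType := Algebra.to_multiplicative int.

Definition F2 : groupType := free 'I_2.

(* Main.v *)
Require Import Defs.
From HB Require Import structures.
From mathcomp Require Import all_boot all_algebra.
From mathcomp Require Import boolp classical_sets.
From mathcomp Require Import ring zify.

(* Put x = x1 and u = x1 x2 x1^-1.  The relations of G(K_3) say that u is equal
   to two conjugates of x, u = phi1 x y u and u = phi2 x y u.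

   (1) When y^2 = 1 and u = z x, they amount to z^3 = 1 and z^x = z^-1.  That z
   and y generate a free product Z_3 * Z_2 is seen by letting x act on Z_3 * Z_2
   as the automorphism inverting Z_3: no normal form is needed.

   (2) phi2 x y improves congruences by one step of the lower central series,
   so modulo gamma_5 the relation u = phi2 x y u just says
   u = u0 := phi2 x y (phi2 x y x).  In the free group on x and y one finds
   u0 = phi1 x y u0 * p^4 mod gamma_5, with p = [x,y,x,x] [x,y,x,y]^-1, hence
   G / gamma_5 is F_2 / gamma_5 with p^4 killed.  Congruences modulo gamma_5 of
   F_2 are decided by the Magnus coefficients of the Lyndon words XXXY, XXYY and
   XYYY and of their factors, read off in 5x5 unitriangular matrices. *)

Set Implicit Arguments.
Unset Strict Implicit.
Unset Printing Implicit Defensive.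

Local Open Scope classical_set_scope.
Local Open Scope group_scope.

Local Notation hom := UMagmaMorphism.type.
Local Notation free := Defs.free.

(** * Isomorphisms, kernels and images *)

Lemma isomorphicP (G H : groupType) (f : hom G H) (g : H -> G) :
  cancel f g -> cancel g f -> isomorphic G H.
Proof. by move=> fK gK; exists f; exists g. Qed.

Lemma isomorphic_sym (G H : groupType) : isomorphic G H -> isomorphic H G.
Proof.
case=> f [g fK gK].
have gM : monoid_morphism g.
  have gM := can2_gmulfM fK gK; split=> //.
  by apply: (mulgI (g 1)); rewrite -gM !mulg1.
pose g' : hom H G := HB.pack g (isUMagmaMorphism.Build H G g gM).
by exists g'; exists f.
Qed.

Lemma bij_surj (G H : Type) (f : G -> H) :
  injective f -> (forall y, exists x, f x = y) -> bijective f.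
Proof.
move=> f_inj /choice[g gK]; exists g => // x.
by apply: f_inj; rewrite gK.
Qed.

Section Kernel.
Variables (G H : groupType) (f : hom G H).

Definition hom_ker : {pred G} := [pred x | f x == 1].

Lemma hom_kerP x : reflect (f x = 1) (x \in hom_ker).
Proof. exact: eqP. Qed.

Lemma hom_ker1 : 1 \in hom_ker.
Proof. by apply/hom_kerP; rewrite gmulf1. Qed.
Lemma hom_kerM : mulg_closed hom_ker.
Proof.
by move=> x y /hom_kerP fx /hom_kerP fy; apply/hom_kerP; rewrite gmulfM fx fy mulg1.
Qed.
Lemma hom_kerV : invg_closed hom_ker.
Proof. by move=> x /hom_kerP fx; apply/hom_kerP; rewrite gmulfV /= fx invg1. Qed.
Lemma hom_kerJ x y : x \in hom_ker -> x ^ y \in hom_ker.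
Proof. by move=> /hom_kerP fx; apply/hom_kerP; rewrite gmulfJ /= fx conj1g. Qed.
HB.instance Definition _ := isMulClosed.Build G hom_ker hom_kerM.
HB.instance Definition _ := isMul1Closed.Build G hom_ker hom_ker1.
HB.instance Definition _ := isInvClosed.Build G hom_ker hom_kerV.
HB.instance Definition _ := isConjClosed.Build G hom_ker hom_kerJ.

Lemma normal_closure_ker (A : set G) : (forall x, A x -> f x = 1) ->
  forall x, x \in normal_closure A -> f x = 1.
Proof.
move=> fA x xA; apply/hom_kerP; apply: (normal_closure_min _ xA) => a Aa.
exact/hom_kerP/fA.
Qed.

End Kernel.

Section Image.
Variables (G H : groupType) (f : hom G H) (S : groupClosed G).

Definition hom_im : {pred H} := [pred y | `[< exists2 x, x \in S & f x = y >]].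

Lemma hom_imP y : reflect (exists2 x, x \in S & f x = y) (y \in hom_im).
Proof. exact: asboolP. Qed.

Lemma hom_im1 : 1 \in hom_im.
Proof. by apply/hom_imP; exists 1; [exact: gpred1 | rewrite gmulf1]. Qed.
Lemma hom_imM : mulg_closed hom_im.
Proof.
move=> _ _ /hom_imP[x Sx <-] /hom_imP[y Sy <-]; apply/hom_imP.
by exists (x * y); [exact: gpredM | rewrite gmulfM].
Qed.
Lemma hom_imV : invg_closed hom_im.
Proof.
move=> _ /hom_imP[x Sx <-]; apply/hom_imP.
by exists x^-1; [rewrite gpredV | rewrite gmulfV].
Qed.
HB.instance Definition _ := isMulClosed.Build H hom_im hom_imM.
HB.instance Definition _ := isMul1Closed.Build H hom_im hom_im1.
HB.instance Definition _ := isInvClosed.Build H hom_im hom_imV.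
End Image.

Lemma hom_image_isomorphic (G H : groupType) (f : hom G H) : injective f ->
  exists K : groupClosed H, isomorphic (subgroup_type K) G.
Proof.
(* [gen setT] is the whole of [G], in the form of a subgroup. *)
move=> f_inj; pose K : groupClosed H := hom_im f (gen setT).
exists K; apply: isomorphic_sym.
have fK x : f x \in K by apply/hom_imP; exists x; rewrite ?mem_gen.
pose g x : subgroup_type K := Subgroup (fK x).
have gM : monoid_morphism g.
  by split=> [|x y]; apply: val_inj; rewrite /= ?gmulf1 ?gmulfM.
pose g' : hom G _ := HB.pack g (isUMagmaMorphism.Build G _ g gM).
exists g'; apply: bij_surj => [x y /(congr1 val)/f_inj//|[y Ky]].
by have /hom_imP[x _ fx] := Ky; exists x; apply: val_inj.
Qed.

(** * Universal properties of free products and of cyclic groups *)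

Section FreeProductHom.
Variables G H : groupType.
Local Notation P := (free_product G H).

Definition fp_inl (x : G) : P := pres_gen _ (inl x).
Definition fp_inr (x : H) : P := pres_gen _ (inr x).

Lemma fp_inl_morphism : monoid_morphism fp_inl.
Proof.
have fM : {morph fp_inl : x y / x * y}.
  move=> x y; have /= := @pres_rel _ (@free_product_rel G H)
    (free_gen (inl x) * free_gen (inl y), free_gen (inl (x * y))).
  rewrite gmulfM /= !free_liftE => -> //; left; by exists x, y.
by split=> //; apply: (mulgI (fp_inl 1)); rewrite -fM !mulg1.
Qed.

Lemma fp_inr_morphism : monoid_morphism fp_inr.
Proof.
have fM : {morph fp_inr : x y / x * y}.
  move=> x y; have /= := @pres_rel _ (@free_product_rel G H)
    (free_gen (inr x) * free_gen (inr y), free_gen (inr (x * y))).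
  rewrite gmulfM /= !free_liftE => -> //; right; by exists x, y.
by split=> //; apply: (mulgI (fp_inr 1)); rewrite -fM !mulg1.
Qed.

HB.instance Definition _ := isUMagmaMorphism.Build G P fp_inl fp_inl_morphism.
HB.instance Definition _ := isUMagmaMorphism.Build H P fp_inr fp_inr_morphism.

Section Copair.
Variables (K : groupType) (f : hom G K) (g : hom H K).

Definition fp_copair_fun (t : (G + H)%type) : K :=
  match t with inl x => f x | inr y => g y end.

Lemma fp_copair_rel p : free_product_rel p ->
  free_lift fp_copair_fun p.1 = free_lift fp_copair_fun p.2.
Proof.
by case=> -[x [y ->]] /=; rewrite gmulfM /= !free_liftE /= gmulfM.
Qed.

Definition fp_copair : hom P K := pres_lift fp_copair_rel.

Lemma fp_copair_inl x : fp_copair (fp_inl x) = f x.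
Proof. exact: pres_liftE. Qed.
Lemma fp_copair_inr x : fp_copair (fp_inr x) = g x.
Proof. exact: pres_liftE. Qed.
End Copair.

Lemma fp_hom_ext (K : groupType) (f g : hom P K) :
  (forall x, f (fp_inl x) = g (fp_inl x)) ->
  (forall x, f (fp_inr x) = g (fp_inr x)) -> f =1 g.
Proof. by move=> fgl fgr; apply: pres_hom_ext => -[]. Qed.
End FreeProductHom.

Section CyclicHom.
Variables (m : nat) (K : groupType) (g : K).
Hypotheses (m_gt1 : (1 < m)%N) (gm : g ^+ m = 1).

Definition cyc_hom (i : cyc m) : K := g ^+ (i : 'Z_m).

Lemma cyc_hom_morphism : monoid_morphism cyc_hom.
Proof.
split; first exact: expg0.
move=> i j; rewrite /cyc_hom -expgnDr.
(* The modulus of ['Z_m] is [(Zp_trunc m).+2], which is m because m > 1. *)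
have -> : ((i * j : cyc m) : 'Z_m) = (i + j) %% m :> nat.
  by rewrite -[X in _ %% X](Zp_cast m_gt1).
by rewrite [in RHS](divn_eq (i + j) m) expgnDr mulnC expgnA gm expg1n mul1g.
Qed.

HB.instance Definition _ :=
  isUMagmaMorphism.Build (cyc m) K cyc_hom cyc_hom_morphism.

Definition cyc_morphism : hom (cyc m) K := cyc_hom.

Lemma cyc_hom_gen : cyc_morphism (1%R : 'Z_m) = g.
Proof.
rewrite [LHS]/(g ^+ ((1%R : 'Z_m) : nat)).
by case: m m_gt1 => [|[|n]].
Qed.
End CyclicHom.

(** The law of [cyc m] is the addition of ['Z_m], so the ring element 1 is a generator and not the
    neutral element. *)
Lemma cyc_expg m (i : cyc m) : i = (1%R : 'Z_m) ^+ (i : 'Z_m) :> cyc m.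
Proof.
have XE n : (1%R : cyc m) ^+ n = (n%:R)%R :> 'Z_m.
  elim: n => // n IH; rewrite expgS mulrS -IH //.
by rewrite XE natr_Zp.
Qed.

Lemma cyc_hom_ext m (K : groupType) (f g : hom (cyc m) K) :
  f (1%R : 'Z_m) = g (1%R : 'Z_m) -> f =1 g.
Proof. by move=> fg i; rewrite (cyc_expg i) !gmulfXn fg. Qed.

(** * The group of K_3 *)

(* With u = x1 x2 x1^-1, the two relations of G(K_3) say that the conjugates
   phi1 and phi2 of x1 are both equal to u. *)
Definition phi1 (G : groupType) (x y u : G) : G :=
  x ^ (u^-1 * (x ^ (y ^- 2))^-1).
Definition phi2 (G : groupType) (x y u : G) : G := x ^ (u ^ (y ^+ 2) * x^-1).

Lemma gmulf_phi1 (G H : groupType) (f : hom G H) x y u :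
  f (phi1 x y u) = phi1 (f x) (f y) (f u).
Proof. by rewrite /phi1 gmulfJ gmulfM !gmulfV gmulfJ gmulfXVn. Qed.

Lemma gmulf_phi2 (G H : groupType) (f : hom G H) x y u :
  f (phi2 x y u) = phi2 (f x) (f y) (f u).
Proof. by rewrite /phi2 gmulfJ gmulfM !gmulfV gmulfJ gmulfXn. Qed.

(** With a = x ^ (y ^- 2), the right-hand side is u conjugated by a u; undoing this conjugation
    isolates u. *)
Lemma rel1P (G : groupType) (x y u : G) :
  x = u^-1 * x^-1 ^ (y ^- 2) * u * x ^ (y ^- 2) * u <-> u = phi1 x y u.
Proof.
rewrite /phi1 conjVg; move: (x ^ (y ^- 2)) => a.
have -> : u^-1 * a^-1 * u * a * u = u ^ (a * u).
  by rewrite /conjg invgM !mulgA.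
rewrite -invgM; move: (a * u) => v.
by split=> [xE|uE]; [rewrite [in RHS]xE conjgK | rewrite [in RHS]uE conjgKV].
Qed.

(** With b = u ^ (y ^+ 2), the relation is x2 = x ^ b, and u is x2 conjugated by x^-1. *)
Lemma rel2P (G : groupType) (x x2 y : G) : let u := x * x2 * x^-1 in
  x2 = u^-1 ^ (y ^+ 2) * x * u ^ (y ^+ 2) <-> u = phi2 x y u.
Proof.
move=> u; rewrite /phi2 conjVg.
have uE : u = x2 ^ x^-1 by rewrite conjgE invgK mulgA.
move: (u ^ (y ^+ 2)) => b.
have -> : b^-1 * x * b = x ^ b by rewrite /conjg mulgA.
rewrite conjgM uE; split=> [->//|/conjg_inj//].
Qed.

Definition gx1 : GK3 := pres_gen _ X1.
Definition gx2 : GK3 := pres_gen _ X2.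
Definition gu : GK3 := gx1 * gx2 * gx1^-1.

Lemma GK3_rel : gu = phi1 gx1 gy gu /\ gu = phi2 gx1 gy gu.
Proof.
have [h [h1 h2 hy] [R1 R2]] : exists2 h : hom F3 GK3,
    [/\ h x_1 = gx1, h x_2 = gx2 & h y_ = gy] &
    h x_1 = h (phiA beta3 x_1) /\ h x_2 = h (phiA beta3 x_2).
  exists (free_lift (pres_gen _)); first by split; apply: free_liftE.
  by split; apply: (@pres_rel _ _ (_, _)); [left|right].
have [E1 E2] := phiA_beta3E; move: R1 R2; rewrite {}E1 {}E2.
rewrite !(gmulfM, gmulfJ, gmulfV, gmulfXVn, gmulfXn) /=.
by rewrite h1 h2 hy => /rel1P r1 /rel2P r2.
Qed.

Lemma GK3_hom (K : groupType) (x y u : K) :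
    u = phi1 x y u -> u = phi2 x y u ->
  exists f : hom GK3 K, [/\ f gx1 = x, f gy = y & f gu = u].
Proof.
(* The equation u = x x2 x^-1 forces this value of x2. *)
move=> r1 r2; pose x2 := u ^ x.
pose v t := match t with X1 => x | X2 => x2 | Y => y end.
have uE : u = x * x2 * x^-1 by rewrite /x2 -{1}(conjgK x u) /conjg invgK mulgA.
have vR p : [set (x_1, phiA beta3 x_1); (x_2, phiA beta3 x_2)] p ->
    free_lift v p.1 = free_lift v p.2.
  suff h12 (h : hom F3 K) : h x_1 = x -> h x_2 = x2 -> h y_ = y ->
      h x_1 = h (phiA beta3 x_1) /\ h x_2 = h (phiA beta3 x_2).
    have [] := h12 (free_lift v); try exact: free_liftE.
    by move=> h1 h2 [] ->.
  have [E1 E2] := phiA_beta3E; rewrite {}E1 {}E2 => h1 h2 hy.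
  rewrite !(gmulfM, gmulfJ, gmulfV, gmulfXVn, gmulfXn) /= h1 h2 hy.
  split; first by rewrite -uE; apply/rel1P.
  by apply/rel2P; rewrite -uE.
have [f1 f2 fy] : [/\ pres_lift vR gx1 = x, pres_lift vR gx2 = x2
    & pres_lift vR gy = y] by split; exact: pres_liftE.
move: (pres_lift vR : hom GK3 K) f1 f2 fy => f f1 f2 fy.
by exists f; split; rewrite // uE /gu !(gmulfM, gmulfV) /= f1 f2.
Qed.

Lemma gx2E : gx2 = gu ^ gx1.
Proof. by rewrite /gu /conjg !mulgA mulVg mul1g mulgVK. Qed.

Lemma GK3_hom_ext (K : groupType) (f g : hom GK3 K) :
  f gx1 = g gx1 -> f gy = g gy -> f gu = g gu -> f =1 g.
Proof.
move=> e1 ey eu; apply: pres_hom_ext => -[] //.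
by rewrite -/gx2 gx2E !gmulfJ /= e1 eu.
Qed.

(** * The quotient by the square of y *)

Lemma conjg_eqE (G : groupType) (a b c : G) : a ^ b = c <-> a * b = b * c.
Proof. by rewrite conjgC; split=> [->//|/mulgI]. Qed.

(** Put z = u / x. When y^2 = 1 the second relation reads x^z = z x, that is x z = z^2 x, which
    moves every z to the left. The first relation then becomes z^5 x^3 = z^2 x^3. *)
Lemma phi_y2_rel (G : groupType) (x y u : G) : y ^+ 2 = 1 ->
    u = phi1 x y u -> u = phi2 x y u ->
  (u / x) ^+ 3 = 1 /\ (u / x) ^ x = (u / x)^-1.
Proof.
rewrite /phi1 /phi2 => ->; rewrite invg1 !conjg1.
have uE : u = (u / x) * x by rewrite mulgVK.
move: (u / x) uE => z ->; rewrite -invgM => r1 r2.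
have xz w : x * (z * w) = z * (z * (x * w)).
  move/esym/conjg_eqE: r2.
  by move/(congr1 (fun a => a * w)); rewrite -!mulgA.
have {}r1 : (z * x) * (x * (z * x)) = x * (z * x) * x.
  by apply/conjg_eqE; rewrite {1}r1 conjgKV.
have z3 : z ^+ 3 = 1.
  apply: (mulIg (z * (z * (x * (x * x))))); rewrite mul1g.
  by move: r1; rewrite expgS expg2 -!mulgA !xz.
have zV : z^-1 = z * z by apply: mulg1_eq; rewrite -z3.
have zzzz : z * (z * (z * z)) = z by rewrite -[RHS]mulg1 -z3.
(* Since z^-1 = z^2, the claim is z x = x z^2, and the right-hand side is z^4 x. *)
split=> //; apply/conjg_eqE; rewrite zV -[RHS]mulg1 -!mulgA !xz mulg1.
by rewrite -[in LHS]zzzz -!mulgA.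
Qed.

Lemma phi_of_rel_y2 (G : groupType) (x y z : G) : y ^+ 2 = 1 ->
    z ^+ 3 = 1 -> z ^ x = z^-1 ->
  z * x = phi1 x y (z * x) /\ z * x = phi2 x y (z * x).
Proof.
rewrite /phi1 /phi2 => -> z3; rewrite invg1 !conjg1 mulgK -invgM.
have zV : z^-1 = z * z by apply: mulg1_eq; rewrite -z3.
have z3E w : z * (z * (z * w)) = w.
  by rewrite -[RHS]mul1g -z3 expgS expg2 -!mulgA.
rewrite {}zV => /conjg_eqE zx.
(* Using z x = x z^2 twice gives z^2 x = x z^4 = x z. *)
have xz w : x * (z * w) = z * (z * (x * w)).
  have zxE v : z * (x * v) = x * (z * (z * v)).
    by move/(congr1 (fun a => a * v)): zx; rewrite -!mulgA.
  by rewrite !zxE z3E.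
split.
  apply: (canRL (conjgK _)); apply/conjg_eqE.
  by rewrite -[RHS]mulg1 -!mulgA !xz mulg1 z3E.
by apply/esym/conjg_eqE; rewrite -[LHS]mulg1 -!mulgA xz mulg1.
Qed.

Definition gX : Gxz := pres_gen _ X.
Definition gZ : Gxz := pres_gen _ Z.

Lemma Gxz_rel : gZ ^+ 3 = 1 /\ gZ ^ gX = gZ^-1.
Proof.
have [h [hX hZ] [R1 R2]] : exists2 h : hom (free xz_letter) Gxz,
    h (free_gen X) = gX /\ h (free_gen Z) = gZ &
    h (free_gen Z ^+ 3) = h 1 /\
      h (free_gen Z ^ free_gen X) = h (free_gen Z)^-1.
  exists (free_lift (pres_gen _)); first by split; apply: free_liftE.
  by split; apply: (@pres_rel _ _ (_, _)); [left|right].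
by move: R1 R2; rewrite gmulfXn gmulfJ gmulfV gmulf1 /= hX hZ.
Qed.

Lemma Gxz_hom (K : groupType) (x z : K) : z ^+ 3 = 1 -> z ^ x = z^-1 ->
  exists f : hom Gxz K, f gX = x /\ f gZ = z.
Proof.
move=> z3 zx; pose v t := match t with X => x | Z => z end.
have vR p :
    [set (free_gen Z ^+ 3, 1); (free_gen Z ^ free_gen X, (free_gen Z)^-1)] p ->
    free_lift v p.1 = free_lift v p.2.
  suff h12 (h : hom (free xz_letter) K) :
      h (free_gen X) = x -> h (free_gen Z) = z ->
      h (free_gen Z ^+ 3) = h 1 /\ h (free_gen Z ^ free_gen X) = h (free_gen Z)^-1.
    have [] := h12 (free_lift v); try exact: free_liftE.
    by move=> h1 h2 [] ->.
  by move=> hX hZ; rewrite gmulfXn gmulfJ gmulfV gmulf1 /= hX hZ.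
by exists (pres_lift vR); split; exact: pres_liftE.
Qed.

Lemma Gxz_hom_ext (K : groupType) (f g : hom Gxz K) :
  f gX = g gX -> f gZ = g gZ -> f =1 g.
Proof. by move=> ex ez; apply: pres_hom_ext => -[]. Qed.

Definition Ky2 : groupType := quot (normal_closure [set gy ^+ 2]).

(** The inverse morphisms are x1 -> x, y -> the generator of Z_2, u -> z x, and back x -> x1, z -> u
    / x1. *)
Lemma Ky2_isomorphic : isomorphic Ky2 (free_product Gxz (cyc 2)).
Proof.
pose P := free_product Gxz (cyc 2).
pose q : hom GK3 Ky2 := quot_proj _.
have qy2 : q gy ^+ 2 = 1.
  by rewrite -gmulfXn; apply/quot_proj_eq1/mem_normal_closure.
pose xP : P := fp_inl _ gX; pose zP : P := fp_inl _ gZ.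
pose c : cyc 2 := (1%R : 'Z_2); pose yP : P := fp_inr _ c.
have yP2 : yP ^+ 2 = 1.
  have c2 : c ^+ 2 = 1 by exact: val_inj.
  by rewrite /yP -gmulfXn /= c2 gmulf1.
have [z3 zx] := Gxz_rel.
have zP3 : zP ^+ 3 = 1 by rewrite /zP -gmulfXn /= z3 gmulf1.
have zPx : zP ^ xP = zP^-1 by rewrite /zP /xP -gmulfJ zx gmulfV.
have [r1 r2] := phi_of_rel_y2 yP2 zP3 zPx.
have [f [fx fy fu]] := GK3_hom r1 r2.
have fN x : x \in normal_closure [set gy ^+ 2] -> f x = 1.
  by apply: normal_closure_ker => _ ->; rewrite gmulfXn /= fy.
pose F : hom Ky2 P := quot_lift fN.
have FE x : F (q x) = f x by exact: quot_liftE.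
have [s1 s2] := GK3_rel.
have qr1 : q gu = phi1 (q gx1) (q gy) (q gu) by rewrite -gmulf_phi1 -s1.
have qr2 : q gu = phi2 (q gx1) (q gy) (q gu) by rewrite -gmulf_phi2 -s2.
have [q3 qx] := phi_y2_rel qy2 qr1 qr2.
have [g [gx gz]] := Gxz_hom q3 qx.
pose E : hom P Ky2 := fp_copair g (cyc_morphism (isT : (1 < 2)%N) qy2).
have ExP : E xP = q gx1 by rewrite /E fp_copair_inl.
have EzP : E zP = q gu / q gx1 by rewrite /E fp_copair_inl.
have EyP : E yP = q gy by rewrite /E fp_copair_inr cyc_hom_gen.
apply: (@isomorphicP _ _ F E).
  elim/quot_ind=> w; rewrite [F _]FE.
  apply: (@GK3_hom_ext _ (E \o f) q).
  - by rewrite /= fx.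
  - by rewrite /= fy.
  - by rewrite -[LHS]/(E (f gu)) fu gmulfM EzP ExP mulgVK.
apply: (@fp_hom_ext _ _ _ (F \o E) idfun) => a /=.
  apply: (@Gxz_hom_ext _ (F \o (E \o @fp_inl _ _)) (@fp_inl _ _)) => /=.
    by rewrite -[LHS]/(F (E xP)) ExP FE.
  by rewrite -[LHS]/(F (E zP)) EzP gmulfF !FE fu fx mulgK.
apply: (@cyc_hom_ext _ _ (F \o (E \o @fp_inr _ _)) (@fp_inr _ _)) => /=.
by rewrite -[LHS]/(F (E yP)) EyP FE.
Qed.

(* The semidirect product of P by aut P, in which (f, p) stands for f * p. *)
Section Holomorph.
Variable P : groupType.

Definition holomorph : Type := (aut P * P)%type.
HB.instance Definition _ := Choice.on holomorph.

Definition hol_mul (u v : holomorph) : holomorph :=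
  (u.1 * v.1, v.1 u.2 * v.2).
Definition hol_inv (u : holomorph) : holomorph := (u.1^-1, u.1^-1 u.2^-1).

Lemma hol_mulA : associative hol_mul.
Proof.
by move=> [f p] [g q] [h r]; congr (_, _); rewrite /= ?mulgA // aut_morph.
Qed.
Lemma hol_mul1 : left_id (1, 1) hol_mul.
Proof. by move=> [f p]; congr (_, _); rewrite /= ?mul1g // gmulf1 mul1g. Qed.
Lemma hol_mulr1 : right_id (1, 1) hol_mul.
Proof. by move=> [f p]; congr (_, _); rewrite /= ?mulg1. Qed.
HB.instance Definition _ := isMonoid.Build holomorph hol_mulA hol_mul1 hol_mulr1.

HB.instance Definition _ := hasInv.Build holomorph hol_inv.
Lemma hol_mulV : left_inverse 1 hol_inv hol_mul.
Proof.
move=> [f p]; congr (_, _); rewrite /= ?mulVg //.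
by rewrite -aut_mulE mulVg /= mulVg.
Qed.
Lemma hol_mulrV : right_inverse 1 hol_inv hol_mul.
Proof.
by move=> [f p]; congr (_, _); rewrite /= ?mulgV // -gmulfM mulgV gmulf1.
Qed.
HB.instance Definition _ := Monoid_isGroup.Build holomorph hol_mulV hol_mulrV.

Definition hol_base (p : P) : holomorph := (1, p).
Lemma hol_base_morphism : monoid_morphism hol_base.
Proof. by split=> // p q; congr (_, _); rewrite mulg1. Qed.
HB.instance Definition _ :=
  isUMagmaMorphism.Build P holomorph hol_base hol_base_morphism.

Lemma hol_baseJ (f : aut P) p : hol_base p ^ ((f, 1) : holomorph) = hol_base (f p).
Proof.
apply/conjg_eqE; congr (_, _); rewrite /= ?mul1g ?mulg1 //.
Qed.
End Holomorph.

(* The automorphism th inverting Z_3 and fixing Z_2 extends the identity of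
   Z_3 * Z_2 to a morphism K from Gxz * Z_2 to its holomorph, x being sent to
   th. *)
Lemma cyc3_cyc2_embeds :
  exists f : hom (free_product (cyc 3) (cyc 2)) (free_product Gxz (cyc 2)),
    injective f.
Proof.
pose P := free_product (cyc 3) (cyc 2).
pose c : cyc 3 := (1%R : 'Z_3).
have c3 : c ^+ 3 = 1 by exact: val_inj.
have cV3 : (c^-1) ^+ 3 = 1 by rewrite expVgn c3 invg1.
pose iV : hom (cyc 3) (cyc 3) := cyc_morphism (isT : (1 < 3)%N) cV3.
have iVc : iV c = c^-1 by exact: cyc_hom_gen.
pose t : hom P P := fp_copair (@fp_inl _ _ \o iV) (@fp_inr _ _).
have tl a : t (fp_inl _ a) = fp_inl _ (iV a) by rewrite /t fp_copair_inl.
have tr a : t (fp_inr _ a) = fp_inr _ a by rewrite /t fp_copair_inr.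
have tK : cancel t t.
  apply: (@fp_hom_ext _ _ _ (t \o t) idfun) => a; rewrite -[LHS]/(t (t _));
    last by rewrite !tr.
  rewrite !tl; apply: (@cyc_hom_ext _ _ (@fp_inl _ _ \o (iV \o iV)) (@fp_inl _ _)).
  by rewrite -[LHS]/(fp_inl _ (iV (iV c))) iVc gmulfV /= iVc invgK.
pose th : aut P := Aut (@gmulfM _ _ t) (Bijective tK tK).
pose H := holomorph P; pose i : hom P H := @hol_base P.
pose zP : P := fp_inl _ c.
have z3 : i zP ^+ 3 = 1 by rewrite -!gmulfXn c3 !gmulf1.
(* Conjugation by [th] acts on the base as [th] itself, so the second relation of [Gxz] holds in the
   holomorph. *)
have zx : i zP ^ ((th, 1) : H) = (i zP)^-1.
  rewrite [LHS]hol_baseJ [th _]tl iVc -[RHS]gmulfV; congr hol_base.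
  exact: gmulfV.
have [k [_ kz]] := Gxz_hom z3 zx.
pose K : hom (free_product Gxz (cyc 2)) H := fp_copair k (i \o @fp_inr _ _).
have [gz3 _] := Gxz_rel.
pose f : hom P (free_product Gxz (cyc 2)) :=
  fp_copair (@fp_inl _ _ \o cyc_morphism (isT : (1 < 3)%N) gz3) (@fp_inr _ _).
(* The inclusion [i] of the base is injective and factors through [f], so [f] is injective. *)
have Kf : K \o f =1 i.
  apply: (@fp_hom_ext _ _ _ (K \o f) i) => a.
    apply: (@cyc_hom_ext _ _ (K \o (f \o @fp_inl _ _)) (i \o @fp_inl _ _)).
    rewrite -[LHS]/(K (f (fp_inl _ c))) [f _]fp_copair_inl.
    rewrite -[X in K X]/(fp_inl _ (cyc_morphism _ _ c)) cyc_hom_gen.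
    by rewrite [K _]fp_copair_inl.
  by rewrite -[LHS]/(K (f _)) [f _]fp_copair_inr [K _]fp_copair_inr.
exists f => p q fpq; have [] // : i p = i q.
by rewrite -[LHS]Kf -[RHS]Kf; exact: (congr1 (fun u => K u) fpq).
Qed.

Lemma Ky2_subgroup : exists H : groupClosed Ky2,
  isomorphic (subgroup_type H) (free_product (cyc 3) (cyc 2)).
Proof.
have [f f_inj] := cyc3_cyc2_embeds.
have [g [h gK hK]] := isomorphic_sym Ky2_isomorphic.
(* An isomorphism is only given as preserving products; that it preserves 1 follows by
   cancellation. *)
have gM : monoid_morphism g.
  by split; [apply: (mulgI (g 1)); rewrite -gmulfM !mulg1 | exact: gmulfM].
pose g' : hom _ Ky2 := HB.pack (g : _ -> _) (isUMagmaMorphism.Build _ _ _ gM).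
apply: (@hom_image_isomorphic _ _ (g' \o f)).
exact: inj_comp (can_inj gK) f_inj.
Qed.

(** * Lower central series *)

Ltac group_word :=
  rewrite /commg /conjg;
  rewrite ?(mulgA, invgM, invgK, mulgK, mulgVK, mulgV, mulVg, mul1g, mulg1, invg1).

Section LowerCentral.
Variable G : groupType.
Local Notation gamma := (lower_central G).

Lemma gammaR n x y : x \in gamma n -> [~ x, y] \in gamma n.+1.
Proof.
by case: n => // n gx; apply: mem_gen; exists x, y.
Qed.

Lemma gammaRl n x y : y \in gamma n -> [~ x, y] \in gamma n.+1.
Proof. by move=> gy; rewrite -gpredV invgR gammaR. Qed.

Lemma gamma_min n (N : groupClosed G) :
    (forall x y, x \in gamma n.+1 -> [~ x, y] \in N) ->
  forall x, x \in gamma n.+2 -> x \in N.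
Proof. by move=> RN x; apply: gen_min => _ [u [v [gu ->]]]; exact: RN. Qed.

Lemma gammaS n x : x \in gamma n.+1 -> x \in gamma n.
Proof.
case: n => // n; apply: (@gamma_min n (gamma n.+1)) => u v gu.
by rewrite commgEl gpredM ?gpredV // gpred_conj.
Qed.

Lemma gamma_leq m n x : (m <= n)%N -> x \in gamma n -> x \in gamma m.
Proof.
move=> mn; rewrite -(subnKC mn); elim: (n - m)%N => [|k IH]; rewrite ?addn0 //.
by rewrite addnS => /gammaS.
Qed.
End LowerCentral.

Section LowerCentralHom.
Variables (G H : groupType) (f : hom G H).

Lemma gamma_hom n x : x \in lower_central G n -> f x \in lower_central H n.
Proof.
case: n => // n; elim: n => [|n IH] in x * => //.
pose S : {pred G} := [pred x | f x \in lower_central H n.+2].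
have SE x' : (x' \in S) = (f x' \in lower_central H n.+2) by [].
have S1 : 1 \in S by rewrite SE gmulf1 gpred1.
have SM : mulg_closed S by move=> u v; rewrite !SE gmulfM; exact: gpredM.
have SV : invg_closed S by move=> u; rewrite !SE gmulfV gpredV.
pose S' : groupClosed G := HB.pack S (isMulClosed.Build G S SM)
  (isMul1Closed.Build G S S1) (isInvClosed.Build G S SV).
apply: (@gamma_min _ n S') => u v gu.
by change (f [~ u, v] \in lower_central H n.+2); rewrite gmulfR gammaR ?IH.
Qed.

Lemma gamma_surj n y : (forall y, exists x, f x = y) ->
  y \in lower_central H n -> exists2 x, x \in lower_central G n & f x = y.
Proof.
move=> f_surj; case: n => [|n].
  by move=> _; have [x fx] := f_surj y; exists x.
elim: n => [|n IH] in y *.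
  by move=> _; have [x fx] := f_surj y; exists x.
move=> gy; apply/hom_imP.
apply: (@gamma_min _ n (hom_im f (lower_central G n.+2))) gy => u v /IH[x gx <-].
have [z <-] := f_surj v.
by apply/hom_imP; exists [~ x, z]; rewrite ?gmulfR // gammaR.
Qed.
End LowerCentralHom.

(** Elements of the n-th term of the quotient lift to the n-th term of [G], which the projection
    kills. *)
Lemma gamma_quot (G : groupType) (n : nat) (z : quot (lower_central G n)) :
  z \in lower_central (quot (lower_central G n)) n -> z = 1.
Proof.
move=> /(gamma_surj (f := quot_proj (lower_central G n)))[|x gx <-].
  by move=> y; exists (repr y); exact: quot_reprK.
exact/quot_proj_eq1.
Qed.

(* In the quotient by N the elements of A are centralised by B, hence by the
   subgroup it generates. *)
Lemma comm_gen (G : groupType) (N : normalSubgroup G) (A B : set G) :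
    (forall a b, A a -> B b -> [~ a, b] \in N) ->
  forall a b, a \in gen A -> b \in gen B -> [~ a, b] \in N.
Proof.
move=> ABN.
(* [C D] is the centraliser of [D] modulo [N], a subgroup because [u v, b] = [u, b]^v [v, b]. *)
pose C (D : {pred G}) : {pred G} :=
  [pred a | `[< forall b, b \in D -> [~ a, b] \in N >]].
have C1 D : 1 \in C D by apply/asboolP=> b _; rewrite comm1g gpred1.
have CM D : mulg_closed (C D).
  move=> u v /asboolP uC /asboolP vC; apply/asboolP=> b Db.
  rewrite commgEl conjMg invgM -mulgA (mulgA u^-1) -commgEl.
  have -> : v^-1 * ([~ u, b] * v ^ b) = [~ u, b] ^ v * [~ v, b].
    by group_word.
  by rewrite gpredM ?vC // gpred_conj ?uC.
have CV D : invg_closed (C D).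
  move=> u /asboolP uC; apply/asboolP=> b Db.
  have -> : [~ u^-1, b] = ([~ u, b] ^ u^-1)^-1.
    by group_word.
  by rewrite gpredV gpred_conj ?uC.
pose C' D : groupClosed G := HB.pack (C D) (isMulClosed.Build G _ (@CM D))
  (isMul1Closed.Build G _ (C1 D)) (isInvClosed.Build G _ (@CV D)).
have gAB a b : a \in gen A -> B b -> [~ a, b] \in N.
  move=> Aa Bb; pose D : {pred G} := [pred z | `[< B z >]].
  have : a \in C' D.
    by apply: gen_min Aa => z Az; apply/asboolP=> w /asboolP; exact: ABN.
  by move/asboolP; apply; apply/asboolP.
move=> a b Aa Bb; rewrite -gpredV invgR.
(* Second pass with the roles exchanged: the subgroup is now the centraliser of all of [gen A]. *)
have : b \in C' (gen A).
  apply: gen_min Bb => z Bz; apply/asboolP=> w Aw.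
  by rewrite -gpredV invgR gAB.
by move/asboolP; apply.
Qed.

Lemma genS (G : groupType) (A B : set G) : A `<=` B -> {subset gen A <= gen B}.
Proof. by move=> AB; apply: gen_min => x Ax; apply/mem_gen/AB. Qed.

(** * Generators of the lower central factors of a two-generator group *)

Section BasicCommutators.
Variables (G : groupType).
Local Notation gamma := (lower_central G).
Local Notation span A n := (gen (A `|` [set` gamma n])).

(** Passage from one factor to the next: modulo the normal subgroup spanned by [A'] and the term n +
    3, the generators of the term n + 1 commute with x and y, hence with everything. *)
Lemma gamma_span_step n (A A' : set G) (x y : G) :
    (forall g, g \in span [set x; y] n.+3) ->
    (forall g, g \in gamma n.+1 -> g \in span A n.+2) ->
    A' `<=` [set` gamma n.+2] ->
    (forall a, A a -> [~ a, x] \in span A' n.+3 /\ [~ a, y] \in span A' n.+3) ->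
  forall g, g \in gamma n.+2 -> g \in span A' n.+3.
Proof.
move=> Gxy gA sA' Axy.
have sN : {subset span A' n.+3 <= gamma n.+2}.
  by apply: gen_min => z [/sA'|/gammaS].
(* Here u^v = u [u, v], and [u, v] lies one term deeper. *)
have NJ u v : u \in span A' n.+3 -> u ^ v \in span A' n.+3.
  move=> Nu; rewrite -(mulVKg u (u ^ v)) -commgEl gpredM //.
  by apply: mem_gen; right; apply/gammaR/sN.
pose N : normalSubgroup G := HB.pack (span A' n.+3)
  (isConjClosed.Build G (span A' n.+3) NJ).
apply: (@gamma_min _ n N) => u v /gA Au.
apply: (comm_gen (N := N) _ Au (Gxy v)) => a b [Aa|ga] [|gb].
- by case=> ->; case: (Axy a Aa).
- by apply: mem_gen; right; apply/gammaS/gammaRl.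
- by move=> _; apply: mem_gen; right; apply: gammaR.
- by apply: mem_gen; right; apply: gammaR.
Qed.


Lemma gamma_spanW m n (A : set G) g : (m <= n)%N -> g \in span A n -> g \in span A m.
Proof.
by move=> mn; apply: genS => z [Az|gz]; [left | right; exact: gamma_leq gz].
Qed.

(* For z in gamma 3 the map [~ z, _] takes central values, hence is a morphism
   to an abelian group. *)
Lemma gamma3_comm (z a b : G) : (forall t, t \in gamma 5 -> t = 1) ->
  z \in gamma 3 -> commute z [~ a, b].
Proof.
move=> g5.
have zJ (w c d : G) : w \in gamma 3 -> w ^ (c * d) = w * [~ w, d] * [~ w, c].
  move=> gw; have /eqP/conjg_fixP wcd : [~ [~ w, c], d] = 1.
    by apply: g5; do 2!apply: gammaR.
  rewrite conjgM -(mulVKg w (w ^ c)) -commgEl conjMg wcd.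
  by rewrite -(mulVKg w (w ^ d)) -commgEl mulgA.
have cR (w c d : G) : w \in gamma 3 -> commute [~ w, c] [~ w, d].
  move=> gw; apply/commgP/eqP/g5/gammaR; exact: gammaR.
move=> gz; apply/commgP/conjg_fixP.
(* Since b a [a, b] = a b, the claim becomes w^(a b) = w^(b a), where [zJ] expands both sides. *)
have [w gw zE] : exists2 w, w \in gamma 3 & z = w ^ (b * a).
  by exists (z ^ (b * a)^-1); [exact: gpred_conj | rewrite conjgKV].
rewrite {1}zE -conjgM -commgC zE !zJ //.
by rewrite -(mulgA w) -[RHS](mulgA w); congr (_ * _); exact: cR.
Qed.

(** In the Lie ring this is the Jacobi identity with [c, [x, y]] = [c, c] = 0. In the group, x y = y
    x c and c commutes with [c, y x], so [c, x y] = [c, y x]; expanding both sides leaves the two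
    triple commutators. *)
Lemma comm_swap (x y : G) (c := [~ x, y]) :
  (forall t, t \in gamma 5 -> t = 1) -> [~ c, x, y] = [~ c, y, x].
Proof.
move=> g5.
have RM (u v w : G) : [~ u, v * w] = [~ u, w] * [~ u, v] * [~ u, v, w].
  by group_word.
have gc : c \in gamma 2 by exact: gammaR.
have c3 z : z \in gamma 3 -> commute z c by exact: gamma3_comm.
have : [~ c, x * y] = [~ c, y * x].
  rewrite commgC -/c RM commgg mul1g.
  have /commgP/eqP-> : commute [~ c, y * x] c by apply/c3/gammaR.
  by rewrite mulg1.
rewrite !RM.
have -> : [~ c, y] * [~ c, x] = [~ c, x] * [~ c, y].
  exact: gamma3_comm (gammaR _ gc).
by move/mulgI.
Qed.

End BasicCommutators.

Section Rank2.
Variables (G : groupType) (x y : G).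
Local Notation gamma := (lower_central G).
Local Notation span A n := (gen (A `|` [set` gamma n])).
Hypothesis Gxy : forall g, g \in span [set x; y] 5.
Let c := [~ x, y].

Lemma gamma1_span g : g \in span [set x; y] 2.
Proof. exact: (gamma_spanW _ (Gxy g)). Qed.

Lemma gamma2_span g : g \in gamma 2 -> g \in span [set c] 3.
Proof.
apply: (@gamma_span_step _ 0 [set x; y] [set c] x y).
- by move=> h; exact: (gamma_spanW _ (Gxy h)).
- by move=> h _; exact: gamma1_span.
- by move=> _ ->; exact: gammaR.
have gc : c \in span [set c] 3 by apply: mem_gen; left.
by move=> _ [] ->; rewrite !commgg !gpred1; split=> //; rewrite -gpredV invgR.
Qed.

Lemma gamma3_span g : g \in gamma 3 -> g \in span [set [~ c, x]; [~ c, y]] 4.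
Proof.
apply: (@gamma_span_step _ 1 [set c] _ x y).
- by move=> h; exact: (gamma_spanW _ (Gxy h)).
- exact: gamma2_span.
- by move=> _ [] ->; do 2!apply: gammaR.
by move=> _ ->; split; apply: mem_gen; left; [left | right].
Qed.

Lemma gamma4_span g : g \in gamma 4 ->
  g \in span [set z | [\/ z = [~ c, x, x], z = [~ c, x, y] | z = [~ c, y, y]]] 5.
Proof.
apply: (@gamma_span_step _ 2 [set [~ c, x]; [~ c, y]] _ x y).
- exact: Gxy.
- exact: gamma3_span.
- by move=> _ [] ->; do 3!apply: gammaR.
move=> _ [] ->; split; try by apply: mem_gen; left; constructor.
(* The fourth commutator [c, y, x] is redundant: it agrees with [c, x, y] modulo the fifth term. *)
rewrite -(mulVKg [~ c, x, y] [~ c, y, x]).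
rewrite gpredM //; apply: mem_gen; first by left; constructor.
right; apply/quot_projP; rewrite /c !gmulfR. apply: comm_swap.
by move=> t; exact: gamma_quot.
Qed.
End Rank2.

Import GRing.Theory.

(** * Integer powers in a group *)

Section IntegerPowers.
Variable G : groupType.
Implicit Types (x y : G) (i j : int).

Definition expgz x i : G :=
  match i with Posz n => x ^+ n | Negz n => x ^- n.+1 end.

(** Writing integers as differences of naturals avoids a case analysis on signs in the laws
    below. *)
Lemma expgz_sub x m n : expgz x (m%:Z - n%:Z)%R = x ^+ m / x ^+ n.
Proof.
have [nm|mn] := leqP n m.
  by rewrite subzn //= expgnFr.
have -> : (m%:Z - n%:Z)%R = Negz (n - m).-1 by lia.
rewrite /= prednK ?subn_gt0 // expgnFr; last exact: ltnW.
by rewrite invgF.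
Qed.

Lemma int_subP i : exists m n : nat, i = (m%:Z - n%:Z)%R.
Proof. by case: i => n; [exists n, 0%N | exists 0%N, n.+1]; lia. Qed.

Lemma expgzN x i : expgz x (- i)%R = (expgz x i)^-1.
Proof. by have [m [n ->]] := int_subP i; rewrite GRing.opprB !expgz_sub invgF. Qed.

Lemma expgzD x i j : expgz x (i + j)%R = expgz x i * expgz x j.
Proof.
have [m [n ->]] := int_subP i; have [p [q ->]] := int_subP j.
have -> : (m%:Z - n%:Z + (p%:Z - q%:Z) = (m + p)%N%:Z - (q + n)%N%:Z)%R by lia.
rewrite !expgz_sub !expgnDr invgM -!mulgA; congr (_ * _).
rewrite !mulgA; congr (_ * _).
by apply/commuteV/commuteX2.
Qed.

Lemma commute_expgz x y i j : commute x y -> commute (expgz x i) (expgz y j).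
Proof.
move=> xy; have comV (a b : G) : commute a b -> commute a^-1 b.
  by move=> ab; apply/commute_sym/commuteV/commute_sym.
by case: i j => m [] n /=; rewrite -?expVgn;
  apply: commuteX2; rewrite ?xy; do ?[exact: commuteV | apply: comV].
Qed.

Lemma expgzM x i n : expgz x (i * n%:Z)%R = expgz (x ^+ n) i.
Proof.
case: i => m; first by rewrite -PoszM /= mulnC expgnA.
by rewrite NegzE mulNr !expgzN -PoszM /= mulnC expgnA.
Qed.

Lemma expgzMl x y i : commute x y -> expgz (x * y) i = expgz x i * expgz y i.
Proof.
move=> xy; case: i => n /=; rewrite expgMn //.
by rewrite (commuteX2 _ _ xy) invgM.
Qed.

Lemma expgzV x i : expgz x^-1 i = expgz x (- i)%R.
Proof. by rewrite expgzN; case: i => n /=; rewrite expVgn. Qed.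

Lemma expgz1 i : expgz 1 i = 1.
Proof. by case: i => n; rewrite /= expg1n ?invg1. Qed.

Lemma gpred_expgz (S : groupClosed G) x i : x \in S -> expgz x i \in S.
Proof. by case: i => n Sx /=; rewrite ?gpredV gpredXn. Qed.

End IntegerPowers.

Lemma gmulf_expgz (G H : groupType) (f : hom G H) x i :
  f (expgz x i) = expgz (f x) i.
Proof. by case: i => n /=; rewrite ?gmulfV gmulfXn. Qed.

Lemma commuteMM (G : groupType) (x y z w : G) : commute y z ->
  (x * y) * (z * w) = (x * z) * (y * w).
Proof. by move=> yz; rewrite -!mulgA; congr (_ * _); rewrite !mulgA yz. Qed.

(** * Coordinates and additive functions on a lower central factor *)

Section Coordinates.
Variables (G : groupType) (n : nat).
Local Notation gamma := (lower_central G).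

(** The factor is central, so the products a^i b^j c^k form a subgroup of it. Three slots suffice up
    to the fourth factor in rank two; spare slots are filled with 1. *)
Lemma gamma_coord (a b c g : G) (A : set G) :
    a \in gamma n.+1 -> b \in gamma n.+1 -> c \in gamma n.+1 ->
    (forall z, A z -> [\/ z = a, z = b | z = c]) ->
    g \in gen (A `|` [set` gamma n.+2]) ->
  exists i j k : int,
    (expgz a i * expgz b j * expgz c k)^-1 * g \in gamma n.+2.
Proof.
move=> ga gb gc sA gA.
pose q : hom G (quot (gamma n.+2)) := quot_proj _.
have qC u v : u \in gamma n.+1 -> commute (q u) (q v).
  move=> gu; apply/commgP/eqP; rewrite -gmulfR.
  exact/quot_proj_eq1/gammaR.
pose E i j k := expgz (q a) i * expgz (q b) j * expgz (q c) k.
have ED i j k i' j' k' : E (i + i')%R (j + j')%R (k + k')%R = E i j k * E i' j' k'.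
  rewrite /E [RHS]commuteMM; last by apply: commuteM; apply/commute_expgz/qC.
  rewrite [X in _ = X * _]commuteMM; last by apply/commute_expgz/qC.
  by rewrite !expgzD.
have E0 : E 0%R 0%R 0%R = 1 by rewrite /E /= !mulg1.
have EN i j k : E (- i)%R (- j)%R (- k)%R = (E i j k)^-1.
  by apply/esym/mulg1_eq; rewrite -ED !GRing.subrr.
pose S : {pred G} := [pred z | `[< exists i j k, q z = E i j k >]].
have S1 : 1 \in S by apply/asboolP; exists 0%R, 0%R, 0%R; rewrite gmulf1.
have SM : mulg_closed S.
  move=> u v /asboolP[i [j [k qu]]] /asboolP[i' [j' [k' qv]]]; apply/asboolP.
  by exists (i + i')%R, (j + j')%R, (k + k')%R; rewrite gmulfM qu qv ED.
have SV : invg_closed S.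
  move=> u /asboolP[i [j [k qu]]]; apply/asboolP.
  by exists (- i)%R, (- j)%R, (- k)%R; rewrite gmulfV qu EN.
pose S' : groupClosed G := HB.pack S (isMulClosed.Build G S SM)
  (isMul1Closed.Build G S S1) (isInvClosed.Build G S SV).
have /asboolP[i [j [k qg]]] : g \in S'.
  apply: gen_min gA => z [/sA zE|gz]; apply/asboolP.
    by case: zE => ->; [exists 1%R, 0%R, 0%R | exists 0%R, 1%R, 0%R
      | exists 0%R, 0%R, 1%R]; rewrite /E /= ?(expg0, expg1, mulg1, mul1g).
  by exists 0%R, 0%R, 0%R; rewrite E0; apply/quot_proj_eq1.
exists i, j, k; apply/quot_projP.
by rewrite -/q 2!gmulfM !gmulf_expgz -/(E i j k).
Qed.

Section Character.
Variables (V : zmodType) (l : G -> V).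
Hypothesis lD : forall u v, u \in gamma n.+1 -> v \in gamma n.+1 ->
  l (u * v) = (l u + l v)%R.
Hypothesis l0 : forall u, u \in gamma n.+2 -> l u = 0%R.

Lemma character_expgz a i : a \in gamma n.+1 -> l (expgz a i) = (l a *~ i)%R.
Proof.
move=> ga.
have lX m : l (a ^+ m) = (l a *+ m)%R.
  elim: m => [|m IH]; first by rewrite l0 ?gpred1.
  by rewrite expgS lD ?gpredXn // IH mulrS.
case: i => m /=; first exact: lX.
rewrite NegzE mulrNz -pmulrn -lX; apply/eqP; rewrite -addr_eq0.
by rewrite -lD ?gpredV ?gpredXn // mulVg l0 ?gpred1.
Qed.

Lemma character_coord a b c g i j k :
    a \in gamma n.+1 -> b \in gamma n.+1 -> c \in gamma n.+1 ->
    (expgz a i * expgz b j * expgz c k)^-1 * g \in gamma n.+2 ->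
  l g = (l a *~ i + l b *~ j + l c *~ k)%R.
Proof.
move=> ga gb gc gN.
have gE := mulVKg (expgz a i * expgz b j * expgz c k) g.
have gaE := gpred_expgz i ga; have gbE := gpred_expgz j gb.
have gcE := gpred_expgz k gc.
rewrite -gE lD; [|by rewrite !gpredM|exact: gammaS].
by rewrite (l0 gN) addr0 !lD ?gpredM // !character_expgz.
Qed.
End Character.
End Coordinates.

(** * Unitriangular matrices *)

(* Upper unitriangular 5x5 matrices, by their entries above the diagonal. *)
Record U5 (R : Type) := MkU5 {
  e12 : R; e23 : R; e34 : R; e45 : R;
  e13 : R; e24 : R; e35 : R; e14 : R; e25 : R; e15 : R }.
HB.instance Definition _ (R : Type) := gen_eqMixin (U5 R).
HB.instance Definition _ (R : Type) := gen_choiceMixin (U5 R).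

Section U5Group.
Variable R : comNzRingType.
Implicit Types a b : U5 R.

Definition U5_one : U5 R := (MkU5 0 0 0 0 0 0 0 0 0 0)%R.

Definition U5_mul a b : U5 R := (MkU5
  (e12 a + e12 b) (e23 a + e23 b) (e34 a + e34 b) (e45 a + e45 b)
  (e13 a + e12 a * e23 b + e13 b)
  (e24 a + e23 a * e34 b + e24 b)
  (e35 a + e34 a * e45 b + e35 b)
  (e14 a + e13 a * e34 b + e12 a * e24 b + e14 b)
  (e25 a + e24 a * e45 b + e23 a * e35 b + e25 b)
  (e15 a + e14 a * e45 b + e13 a * e35 b + e12 a * e25 b + e15 b))%R.

(** The entries of 1 - N + N^2 - N^3 + N^4 for the matrix 1 + N, where N^5 = 0. *)
Definition U5_inv a : U5 R := (MkU5
  (- e12 a) (- e23 a) (- e34 a) (- e45 a)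
  (e12 a * e23 a - e13 a) (e23 a * e34 a - e24 a) (e34 a * e45 a - e35 a)
  (e12 a * e24 a + e13 a * e34 a - e12 a * e23 a * e34 a - e14 a)
  (e23 a * e35 a + e24 a * e45 a - e23 a * e34 a * e45 a - e25 a)
  (e12 a * e25 a + e13 a * e35 a + e14 a * e45 a - e12 a * e23 a * e35 a
    - e12 a * e24 a * e45 a - e13 a * e34 a * e45 a
    + e12 a * e23 a * e34 a * e45 a - e15 a))%R.

Lemma U5_mulA : associative U5_mul.
Proof. by move=> a b c; rewrite /U5_mul /=; congr MkU5; ring. Qed.
Lemma U5_mul1 : left_id U5_one U5_mul.
Proof. by case=> *; rewrite /U5_mul /=; congr MkU5; ring. Qed.
Lemma U5_mulr1 : right_id U5_one U5_mul.
Proof. by case=> *; rewrite /U5_mul /=; congr MkU5; ring. Qed.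
HB.instance Definition _ := isMonoid.Build (U5 R) U5_mulA U5_mul1 U5_mulr1.

HB.instance Definition _ := hasInv.Build (U5 R) U5_inv.
Lemma U5_mulV : left_inverse 1 U5_inv U5_mul.
Proof. by move=> a; rewrite /U5_mul /=; congr MkU5; ring. Qed.
Lemma U5_mulrV : right_inverse 1 U5_inv U5_mul.
Proof. by move=> a; rewrite /U5_mul /=; congr MkU5; ring. Qed.
HB.instance Definition _ := Monoid_isGroup.Build (U5 R) U5_mulV U5_mulrV.

(** Matrices whose first n - 1 superdiagonals vanish: a central filtration, hence containing the
    lower central series. *)
Definition U5_fil (n : nat) : {pred U5 R} := [pred a |
  [&& (1 < n)%N ==> [&& e12 a == 0, e23 a == 0, e34 a == 0 & e45 a == 0],
      (2 < n)%N ==> [&& e13 a == 0, e24 a == 0 & e35 a == 0],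
      (3 < n)%N ==> (e14 a == 0) && (e25 a == 0)
    & (4 < n)%N ==> (e15 a == 0)]%R].

Definition U5_filE n a := erefl : (a \in U5_fil n) = 
  [&& (1 < n)%N ==> [&& e12 a == 0, e23 a == 0, e34 a == 0 & e45 a == 0],
      (2 < n)%N ==> [&& e13 a == 0, e24 a == 0 & e35 a == 0],
      (3 < n)%N ==> (e14 a == 0) && (e25 a == 0)
    & (4 < n)%N ==> (e15 a == 0)]%R.

Lemma U5_fil1 n : 1 \in U5_fil n.
Proof. by rewrite U5_filE /= !eqxx !implybT. Qed.

Ltac U5_fil_tac := rewrite !U5_filE /=;
  repeat match goal with
  | |- is_true true -> _ => move=> _
  | |- is_true (_ && _) -> _ => case/andP
  | |- is_true (_ == _) -> _ => move/eqP=> ?; subst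
  end;
  repeat match goal with |- is_true (_ && _) => apply/andP; split end;
  try apply/eqP; try done; ring.

Lemma U5_filM n : mulg_closed (U5_fil n).
Proof.
move=> [a1 a2 a3 a4 a5 a6 a7 a8 a9 a10] [b1 b2 b3 b4 b5 b6 b7 b8 b9 b10].
by case: n => [|[|[|[|[|n]]]]]; U5_fil_tac.
Qed.

Lemma U5_filV n : invg_closed (U5_fil n).
Proof.
move=> [a1 a2 a3 a4 a5 a6 a7 a8 a9 a10].
by case: n => [|[|[|[|[|n]]]]]; U5_fil_tac.
Qed.

Lemma U5_filR n a b : a \in U5_fil n -> [~ a, b] \in U5_fil n.+1.
Proof.
case: a b => [a1 a2 a3 a4 a5 a6 a7 a8 a9 a10] [b1 b2 b3 b4 b5 b6 b7 b8 b9 b10].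
by case: n => [|[|[|[|[|n]]]]]; U5_fil_tac.
Qed.
HB.instance Definition _ n := isMulClosed.Build (U5 R) (U5_fil n) (@U5_filM n).
HB.instance Definition _ n := isMul1Closed.Build (U5 R) (U5_fil n) (U5_fil1 n).
HB.instance Definition _ n := isInvClosed.Build (U5 R) (U5_fil n) (@U5_filV n).

Lemma gamma_U5 n a : a \in lower_central (U5 R) n -> a \in U5_fil n.
Proof.
case: n => // n; elim: n => [|n IH] in a * => //.
by apply: (@gamma_min _ n (U5_fil n.+2)) => u v /IH; exact: U5_filR.
Qed.

Lemma gamma5_U5 a : a \in lower_central (U5 R) 5 -> a = 1.
Proof.
move/gamma_U5; case: a => [a1 a2 a3 a4 a5 a6 a7 a8 a9 a10].
by rewrite U5_filE /= => /and4P[/and4P[/eqP-> /eqP-> /eqP-> /eqP->]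
  /and3P[/eqP-> /eqP-> /eqP->] /andP[/eqP-> /eqP->] /eqP->].
Qed.

(** Satisfied by the entries of the n-th superdiagonal; pulled back along a representation, they
    read coordinates in the n-th lower central factor. *)
Definition U5_character n (e : U5 R -> R) : Prop :=
  (forall a b, a \in U5_fil n -> b \in U5_fil n -> e (a * b) = (e a + e b)%R) /\
  (forall a, a \in U5_fil n.+1 -> e a = 0%R).

Ltac U5_character_tac :=
  split=> [[a1 a2 a3 a4 a5 a6 a7 a8 a9 a10] [b1 b2 b3 b4 b5 b6 b7 b8 b9 b10]
    |[a1 a2 a3 a4 a5 a6 a7 a8 a9 a10]]; rewrite !U5_filE /=;
  repeat match goal with
  | |- is_true true -> _ => move=> _
  | |- is_true (_ && _) -> _ => case/andP
  | |- is_true (_ == _) -> _ => move/eqP=> ?; subst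
  end; ring.

Lemma e12_character : U5_character 1 (@e12 R). Proof. U5_character_tac. Qed.
Lemma e45_character : U5_character 1 (@e45 R). Proof. U5_character_tac. Qed.
Lemma e35_character : U5_character 2 (@e35 R). Proof. U5_character_tac. Qed.
Lemma e25_character : U5_character 3 (@e25 R). Proof. U5_character_tac. Qed.
Lemma e15_character : U5_character 4 (@e15 R). Proof. U5_character_tac. Qed.

Section Pullback.
Variables (n : nat) (e : U5 R -> R) (G : groupType) (f : hom G (U5 R)).
Hypothesis e_char : U5_character n.+1 e.

Lemma U5_pullD u v :
    u \in lower_central G n.+1 -> v \in lower_central G n.+1 ->
  e (f (u * v)) = (e (f u) + e (f v))%R.
Proof.
move=> gu gv; rewrite gmulfM; case: e_char => -> //; exact/gamma_U5/gamma_hom.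
Qed.

Lemma U5_pull0 u : u \in lower_central G n.+2 -> e (f u) = 0%R.
Proof. by move=> gu; case: e_char => _ -> //; exact/gamma_U5/gamma_hom. Qed.

Lemma U5_coord (a b c g : G) i j k :
    a \in lower_central G n.+1 -> b \in lower_central G n.+1 ->
    c \in lower_central G n.+1 ->
    (expgz a i * expgz b j * expgz c k)^-1 * g \in lower_central G n.+2 ->
  e (f g) = (e (f a) *~ i + e (f b) *~ j + e (f c) *~ k)%R.
Proof. exact: (character_coord (l := e \o f) U5_pullD U5_pull0). Qed.
End Pullback.

End U5Group.

(* The representation with x = 1 + sum a_i E_(i,i+1) and
   y = 1 + sum b_i E_(i,i+1): its entries in degree k are the coefficients of
   the Magnus expansion contracted against a product of k consecutive linear
   forms a_i X* + b_i Y*. *)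
Definition U5_diag (R : comNzRingType) (a1 a2 a3 a4 : R) : U5 R :=
  MkU5 a1 a2 a3 a4 0%R 0%R 0%R 0%R 0%R 0%R.

(** * Magnus coefficients of F_2 *)

Lemma free_genP (T : choiceType) (S : groupClosed (free T)) :
  (forall t, free_gen t \in S) -> forall g, g \in S.
Proof.
move=> gS; elim/free_ind; elim=> [|[b t] w IH].
  by rewrite free_class_nil gpred1.
rewrite -cat1s free_class_cat gpredM //; case: b; last exact: gS.
have -> : free_class [:: (true, t)] = (free_gen t)^-1 by rewrite -free_class_inv.
by rewrite gpredV.
Qed.

Lemma pres_genP (T : choiceType) (R : set (free T * free T))
    (S : groupClosed (presented R)) :
  (forall t, pres_gen R t \in S) -> forall g, g \in S.
Proof.
move=> gS g; pose q : hom (free T) (presented R) := quot_proj _.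
have : g \in hom_im (free_lift (pres_gen R)) (gen setT).
  apply/hom_imP; exists (repr g); first exact: mem_gen.
  rewrite -[RHS]quot_reprK; apply: (@free_hom_ext _ _ (free_lift _) q) => t.
  exact: free_liftE.
move=> /hom_imP[w _ <-].
pose K : {pred free T} := [pred w | free_lift (pres_gen R) w \in S].
have KE w' : (w' \in K) = (free_lift (pres_gen R) w' \in S) by [].
have K1 : 1 \in K by rewrite KE gmulf1 gpred1.
have KM : mulg_closed K by move=> u v; rewrite !KE gmulfM; exact: gpredM.
have KV : invg_closed K by move=> u; rewrite !KE gmulfV gpredV.
pose K' : groupClosed (free T) := HB.pack K (isMulClosed.Build _ K KM)
  (isMul1Closed.Build _ K K1) (isInvClosed.Build _ K KV).
by apply: (@free_genP _ K') => t; change (free_lift (pres_gen R) (free_gen t) \in S);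
  rewrite free_liftE.
Qed.

Definition F2_x : F2 := free_gen (@Ordinal 2 0 isT).
Definition F2_y : F2 := free_gen (@Ordinal 2 1 isT).

Definition F2_lift (G : groupType) (x y : G) : hom F2 G :=
  free_lift (fun i : 'I_2 => if i == 0%N :> nat then x else y).

Lemma F2_lift_x (G : groupType) (x y : G) : F2_lift x y F2_x = x.
Proof. exact: free_liftE. Qed.
Lemma F2_lift_y (G : groupType) (x y : G) : F2_lift x y F2_y = y.
Proof. exact: free_liftE. Qed.

Lemma F2_hom_ext (G : groupType) (f g : hom F2 G) :
  f F2_x = g F2_x -> f F2_y = g F2_y -> f =1 g.
Proof.
move=> ex ey; apply: free_hom_ext => -[[|[|//]] lt_i2].
- by move: ex; rewrite /F2_x (_ : isT = lt_i2) //; exact: bool_irrelevance.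
- by move: ey; rewrite /F2_y (_ : isT = lt_i2) //; exact: bool_irrelevance.
Qed.

Lemma F2_span n g : g \in gen ([set F2_x; F2_y] `|` [set` lower_central F2 n]).
Proof.
apply: free_genP => -[[|[|//]] lt_i2]; apply: mem_gen; left; [left | right].
- by rewrite /F2_x (_ : isT = lt_i2) //; exact: bool_irrelevance.
- by rewrite /F2_y (_ : isT = lt_i2) //; exact: bool_irrelevance.
Qed.

(* Coefficients of the Lyndon words XXXY, XXYY and XYYY. *)
Definition rep31 : hom F2 (U5 int) :=
  F2_lift (U5_diag 1 1 1 0)%R (U5_diag 0 0 0 1)%R.
Definition rep22 : hom F2 (U5 int) :=
  F2_lift (U5_diag 1 1 0 0)%R (U5_diag 0 0 1 1)%R.
Definition rep13 : hom F2 (U5 int) :=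
  F2_lift (U5_diag 1 0 0 0)%R (U5_diag 0 1 1 1)%R.

Lemma gamma4_coord (G : groupType) (x y : G) :
    (forall g, g \in gen ([set x; y] `|` [set` lower_central G 5])) ->
    forall g, g \in lower_central G 4 -> exists i j k : int,
  (expgz [~ x, y, x, x] i * expgz [~ x, y, x, y] j * expgz [~ x, y, y, y] k)^-1
    * g \in lower_central G 5.
Proof.
move=> Gxy g /(gamma4_span Gxy); apply: gamma_coord => //;
  by do 3!apply: gammaR.
Qed.

Ltac F2_eval :=
  rewrite /rep31 /rep22 /rep13 ?gmulfR ?F2_lift_x ?F2_lift_y;
  vm_compute; reflexivity.

(** On the three generating commutators the corner entries of the three representations form the
    matrix diag(1, -1, 1), so their vanishing forces i = j = k = 0. *)
Lemma F2_gamma5P g : g \in lower_central F2 4 -> e15 (rep31 g) = 0%R ->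
  e15 (rep22 g) = 0%R -> e15 (rep13 g) = 0%R -> g \in lower_central F2 5.
Proof.
move=> g4; have [i [j [k gE]]] := gamma4_coord (@F2_span 5) g4.
have [ga gb gc] : [/\ [~ F2_x, F2_y, F2_x, F2_x] \in lower_central F2 4,
    [~ F2_x, F2_y, F2_x, F2_y] \in lower_central F2 4
  & [~ F2_x, F2_y, F2_y, F2_y] \in lower_central F2 4] by split; do 3!apply: gammaR.
have coord f := U5_coord f (e15_character _) ga gb gc gE.
rewrite (coord _ rep31) (coord _ rep22) (coord _ rep13).
have -> : e15 (rep31 [~ F2_x, F2_y, F2_x, F2_x]) = 1%R by F2_eval.
have -> : e15 (rep31 [~ F2_x, F2_y, F2_x, F2_y]) = 0%R by F2_eval.
have -> : e15 (rep31 [~ F2_x, F2_y, F2_y, F2_y]) = 0%R by F2_eval.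
have -> : e15 (rep22 [~ F2_x, F2_y, F2_x, F2_x]) = 0%R by F2_eval.
have -> : e15 (rep22 [~ F2_x, F2_y, F2_x, F2_y]) = (- 1)%R by F2_eval.
have -> : e15 (rep22 [~ F2_x, F2_y, F2_y, F2_y]) = 0%R by F2_eval.
have -> : e15 (rep13 [~ F2_x, F2_y, F2_x, F2_x]) = 0%R by F2_eval.
have -> : e15 (rep13 [~ F2_x, F2_y, F2_x, F2_y]) = 0%R by F2_eval.
have -> : e15 (rep13 [~ F2_x, F2_y, F2_y, F2_y]) = 1%R by F2_eval.
rewrite !mul0rz !mulNrz !intz !addr0 !add0r => i0 j0 k0; move: gE.
have -> : i = 0%R by lia. have -> : j = 0%R by lia. have -> : k = 0%R by lia.
by rewrite /= !mulg1 invg1 mul1g.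
Qed.

(** The entry [e25] skips the first linear form, so it reads XXY in [rep31] and XYY in [rep22]; the
    matrix on the generators is diag(-1, 1). *)
Lemma F2_gamma4P g : g \in lower_central F2 3 -> e25 (rep31 g) = 0%R ->
  e25 (rep22 g) = 0%R -> g \in lower_central F2 4.
Proof.
move=> /(gamma3_span (@F2_span 5)) gA.
have [ga gb] : [~ F2_x, F2_y, F2_x] \in lower_central F2 3 /\
    [~ F2_x, F2_y, F2_y] \in lower_central F2 3 by split; do 2!apply: gammaR.
have [|i [j [k gE]]] := gamma_coord ga gb gpred1 _ gA.
  by move=> z []; constructor.
have coord f := U5_coord f (e25_character _) ga gb gpred1 gE.
rewrite (coord _ rep31) (coord _ rep22).
rewrite !gmulf1 !(erefl : e25 (1 : U5 int) = 0%R).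
have -> : e25 (rep31 [~ F2_x, F2_y, F2_x]) = (- 1)%R by F2_eval.
have -> : e25 (rep31 [~ F2_x, F2_y, F2_y]) = 0%R by F2_eval.
have -> : e25 (rep22 [~ F2_x, F2_y, F2_x]) = 0%R by F2_eval.
have -> : e25 (rep22 [~ F2_x, F2_y, F2_y]) = 1%R by F2_eval.
rewrite !mul0rz !mulNrz !intz !addr0 !add0r => i0 j0; move: gE.
have -> : i = 0%R by lia. have -> : j = 0%R by lia.
by rewrite expgz1 /= !mulg1 invg1 mul1g.
Qed.

(** The last two linear forms of [rep31] read the word XY. *)
Lemma F2_gamma3P g : g \in lower_central F2 2 -> e35 (rep31 g) = 0%R ->
  g \in lower_central F2 3.
Proof.
move=> /(gamma2_span (@F2_span 5)) gA.
have ga : [~ F2_x, F2_y] \in lower_central F2 2 by exact: gammaR.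
have [|i [j [k gE]]] := gamma_coord ga gpred1 gpred1 _ gA.
  by move=> z ->; constructor.
have coord f := U5_coord f (e35_character _) ga gpred1 gpred1 gE.
rewrite (coord _ rep31).
rewrite !gmulf1 !(erefl : e35 (1 : U5 int) = 0%R).
have -> : e35 (rep31 [~ F2_x, F2_y]) = 1%R by F2_eval.
rewrite !mul0rz !intz !addr0 => i0; move: gE; rewrite i0.
by rewrite !expgz1 /= !mulg1 invg1 mul1g.
Qed.

(** The first and last linear forms of [rep31] give the exponent sums in x and y. *)
Lemma F2_gamma2P g : e12 (rep31 g) = 0%R -> e45 (rep31 g) = 0%R ->
  g \in lower_central F2 2.
Proof.
have gA := gamma1_span (@F2_span 5) g.
have [|i [j [k gE]]] := @gamma_coord _ 0 F2_x F2_y 1 _ _ isT isT isT _ gA.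
  by move=> z []; constructor.
rewrite (U5_coord rep31 (e12_character _) _ _ _ gE) //.
rewrite (U5_coord rep31 (e45_character _) _ _ _ gE) //.
rewrite !gmulf1 !(erefl : e12 (1 : U5 int) = 0%R) !(erefl : e45 (1 : U5 int) = 0%R).
have -> : e12 (rep31 F2_x) = 1%R by F2_eval.
have -> : e12 (rep31 F2_y) = 0%R by F2_eval.
have -> : e45 (rep31 F2_x) = 0%R by F2_eval.
have -> : e45 (rep31 F2_y) = 1%R by F2_eval.
rewrite !mul0rz !intz !addr0 add0r => i0 j0; move: gE; rewrite i0 j0.
by rewrite !expgz1 /= !mulg1 invg1 mul1g.
Qed.

(** Descends the lower central series one term at a time; congruences modulo the fifth term become
    computations with integer matrices. *)
Lemma F2_magnus g : rep31 g = 1 -> rep22 g = 1 -> rep13 g = 1 ->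
  g \in lower_central F2 5.
Proof.
move=> g31 g22 g13.
have g2 : g \in lower_central F2 2 by apply: F2_gamma2P; rewrite g31.
have g3 : g \in lower_central F2 3 by apply: F2_gamma3P; rewrite ?g31.
have g4 : g \in lower_central F2 4 by apply: F2_gamma4P; rewrite ?g31 ?g22.
by apply: F2_gamma5P; rewrite ?g31 ?g22 ?g13.
Qed.

(** * Nilpotent quotients of the group of K_3 *)

Section FixedPoint.
Variables (G : groupType) (x y : G).
Local Notation gamma := (lower_central G).

(** If a and b agree modulo the n-th term, then x^a and x^b differ by [x^a, a^-1 b], which lies in
    the next term. *)
Lemma phi2_contract n u v : u^-1 * v \in gamma n ->
  (phi2 x y u)^-1 * phi2 x y v \in gamma n.+1.
Proof.
rewrite /phi2; move: (y ^+ 2) => t guv.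
have : (u ^ t)^-1 * v ^ t \in gamma n by rewrite -conjVg -conjMg gpred_conj.
move: (u ^ t) (v ^ t) => a b gab; rewrite !(conjgM x).
rewrite -conjVg -conjMg gpred_conj //.
have -> : (x ^ a)^-1 * x ^ b = [~ x ^ a, a^-1 * b].
  by rewrite commgEl -conjgM mulVKg.
exact: gammaRl.
Qed.

(** The element is the commutator of x with a conjugate of [x, y^2]. *)
Lemma phi2_gamma3 : x^-1 * phi2 x y x \in gamma 3.
Proof.
rewrite -commgEl gammaRl //; move: (y ^+ 2) => t.
have -> : x ^ t * x^-1 = [~ x, t] ^ x^-1 by group_word.
by rewrite gpred_conj // gammaR.
Qed.

(** The seed x is fixed modulo the third term, so two iterations give a point fixed modulo the
    fifth. *)
Definition u0 : G := phi2 x y (phi2 x y x).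

Lemma u0_fixed : u0^-1 * phi2 x y u0 \in gamma 5.
Proof. by do 2!apply: phi2_contract; exact: phi2_gamma3. Qed.

Lemma u0_unique u : u = phi2 x y u -> u^-1 * u0 \in gamma 5.
Proof.
move=> uE; have step n v : u^-1 * v \in gamma n ->
    u^-1 * phi2 x y v \in gamma n.+1.
  by move/phi2_contract; rewrite -uE.
apply/step/step; have g2 : u^-1 * x \in gamma 2.
  by rewrite -gpredV invgM invgK uE -commgEl gammaR.
(* A fixed point is a conjugate of x, which gives agreement modulo the second term only. One
   contraction, corrected by [phi2_gamma3], reaches the third. *)
have -> : u^-1 * x = (u^-1 * phi2 x y x) * (x^-1 * phi2 x y x)^-1.
  by move: (phi2 x y x) => t; group_word.
by rewrite gpredF ?step ?phi2_gamma3.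
Qed.

Lemma u0_gen (S : groupClosed G) : x \in S -> y \in S -> u0 \in S.
Proof.
by move=> Sx Sy; rewrite /u0 /phi2 !(gpredJ, gpredM, gpredV, gpredXn).
Qed.

(** The element p whose fourth power separates the two relations. *)
Definition obstruction : G := [~ x, y, x, x] / [~ x, y, x, y].

Lemma obstruction_gamma4 : obstruction \in gamma 4.
Proof. by rewrite gpredF //; do 3!apply: gammaR. Qed.
End FixedPoint.

Lemma gmulf_u0 (G H : groupType) (f : hom G H) x y :
  f (u0 x y) = u0 (f x) (f y).
Proof. by rewrite /u0 !gmulf_phi2. Qed.

Lemma gmulf_obstruction (G H : groupType) (f : hom G H) x y :
  f (obstruction x y) = obstruction (f x) (f y).
Proof. by rewrite /obstruction gmulfF !gmulfR. Qed.

(** The congruence u0 = phi1 x y u0 * p^4 gathered in a single element, to be evaluated in matrices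
    and carried along morphisms. *)
Definition rel1_defect (G : groupType) (x y : G) : G :=
  (phi1 x y (u0 x y) * obstruction x y ^+ 4)^-1 * u0 x y.

Lemma gmulf_rel1_defect (G H : groupType) (f : hom G H) x y :
  f (rel1_defect x y) = rel1_defect (f x) (f y).
Proof.
by rewrite /rel1_defect gmulfM gmulf_u0 gmulfV gmulfM gmulfXn gmulf_phi1
  gmulf_u0 gmulf_obstruction.
Qed.

Lemma F2_rel1 : rel1_defect F2_x F2_y \in lower_central F2 5.
Proof.
by apply: F2_magnus; rewrite gmulf_rel1_defect /rep31 /rep22 /rep13 F2_lift_x
  F2_lift_y; vm_compute; reflexivity.
Qed.

(** Any such pair x, y is the image of the free generators, so the congruence found in [F2]
    specialises to an equality. *)
Lemma class4_rel1 (K : groupType) (x y : K) :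
  (forall z, z \in lower_central K 5 -> z = 1) ->
  u0 x y = phi1 x y (u0 x y) * obstruction x y ^+ 4.
Proof.
move=> K5; have /K5 := gamma_hom (F2_lift x y) F2_rel1.
rewrite gmulf_rel1_defect F2_lift_x F2_lift_y.
by move/mulg1_eq; rewrite invgK.
Qed.

(** In class at most 4, u0 solves the second relation, and the first one reduces to p^4 = 1. *)
Lemma GK3_class4_hom (K : groupType) (x y : K) :
    (forall z, z \in lower_central K 5 -> z = 1) -> obstruction x y ^+ 4 = 1 ->
  exists f : hom GK3 K, [/\ f gx1 = x, f gy = y & f gu = u0 x y].
Proof.
move=> K5 o4; apply: GK3_hom.
  by rewrite {1}class4_rel1 // o4 mulg1.
by have /mulg1_eq := K5 _ (u0_fixed x y); rewrite invgK.
Qed.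

Lemma gu_gamma5 : gu^-1 * u0 gx1 gy \in lower_central GK3 5.
Proof. by apply: u0_unique; case: GK3_rel. Qed.

(** Modulo the fifth term u is the word u0 in x1 and y, so it adds no generator. *)
Lemma GK3_span g : g \in gen ([set gx1; gy] `|` [set` lower_central GK3 5]).
Proof.
pose S : groupClosed GK3 := gen ([set gx1; gy] `|` [set` lower_central GK3 5]).
have Sx : gx1 \in S by apply: mem_gen; left; left.
have Sy : gy \in S by apply: mem_gen; left; right.
have Su : gu \in S.
  rewrite -gpredV -(mulgK (u0 gx1 gy) gu^-1) gpredM ?gpredV ?u0_gen //.
  by apply: mem_gen; right; exact: gu_gamma5.
by apply: (@pres_genP _ _ S) => -[] //; rewrite -/gx2 gx2E gpredJ.
Qed.

Lemma GK3_obstruction : obstruction gx1 gy ^+ 4 \in lower_central GK3 5.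
Proof.
pose q : hom GK3 (quot (lower_central GK3 5)) := quot_proj _.
apply/quot_proj_eq1; rewrite -/q gmulfXn gmulf_obstruction.
have := class4_rel1 (q gx1) (q gy) (@gamma_quot _ _).
have qu : q gu = u0 (q gx1) (q gy).
  by rewrite -gmulf_u0; apply/quot_projP/gu_gamma5.
have [r1 _] := GK3_rel; rewrite -{}qu -gmulf_phi1 -r1.
by move/(congr1 (fun t => (q gu)^-1 * t)); rewrite mulVg mulKg.
Qed.

(** The obstruction lies in the fourth term, so it disappears here and matching the generators gives
    inverse morphisms. *)
Lemma GK3_mod_gamma4 :
  isomorphic (quot (lower_central GK3 4)) (quot (lower_central F2 4)).
Proof.
pose q : hom GK3 (quot (lower_central GK3 4)) := quot_proj _.
pose p : hom F2 (quot (lower_central F2 4)) := quot_proj _.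
have p5 z : z \in lower_central (quot (lower_central F2 4)) 5 -> z = 1.
  by move/gammaS/gamma_quot.
have po : obstruction (p F2_x) (p F2_y) ^+ 4 = 1.
  have o1 : p (obstruction F2_x F2_y) = 1 by exact/quot_proj_eq1/obstruction_gamma4.
  by rewrite -gmulf_obstruction o1 expg1n.
have [f [f1 F2_y' fu]] := GK3_class4_hom p5 po.
have fN w : w \in lower_central GK3 4 -> f w = 1.
  by move/(gamma_hom f)/gamma_quot.
pose h := F2_lift (q gx1) (q gy).
have hN w : w \in lower_central F2 4 -> h w = 1.
  by move/(gamma_hom h)/gamma_quot.
pose F : hom _ _ := quot_lift fN; pose E : hom _ _ := quot_lift hN.
have FE w : F (q w) = f w by exact: quot_liftE.
have EE w : E (p w) = h w by exact: quot_liftE.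
have hx : h F2_x = q gx1 by exact: F2_lift_x.
have hy : h F2_y = q gy by exact: F2_lift_y.
apply: (@isomorphicP _ _ F E).
  elim/quot_ind=> w; apply: (@GK3_hom_ext _ (E \o (F \o q)) q).
  - by rewrite -[LHS]/(E (F (q _))) FE f1 EE hx.
  - by rewrite -[LHS]/(E (F (q _))) FE F2_y' EE hy.
  rewrite -[LHS]/(E (F (q _))) FE fu -gmulf_u0 EE gmulf_u0 hx hy -gmulf_u0.
  apply/esym/quot_projP; apply: gammaS; exact: gu_gamma5.
elim/quot_ind=> w; apply: (@F2_hom_ext _ (F \o (E \o p)) p).
  by rewrite -[LHS]/(F (E (p _))) EE hx FE f1.
by rewrite -[LHS]/(F (E (p _))) EE hy FE F2_y'.
Qed.

(** The corner entries are additive on the fourth term with values in the integers, where m can be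
    cancelled. *)
Lemma F2_gamma4_torsion_free w m : w \in lower_central F2 4 -> (0 < m)%N ->
  w ^+ m \in lower_central F2 5 -> w \in lower_central F2 5.
Proof.
move=> w4 m0 wm.
have coord (f : hom F2 (U5 int)) : e15 (f w) = 0%R.
  have := U5_pull0 f (e15_character _) wm.
  rewrite -[w ^+ m]/(expgz w m).
  rewrite -[e15 _]/((@e15 int \o f) _) (character_expgz _ _ _ w4).
  - by move/eqP; rewrite mulrz_eq0; case/orP => [|/eqP //]; lia.
  - exact: (U5_pullD f (e15_character _)).
  - exact: (U5_pull0 f (e15_character _)).
exact: F2_gamma5P.
Qed.

(** * Unitriangular representations of the group of K_3 *)

Lemma U5_class4_hom (R : comNzRingType) (a b : U5 R) : obstruction a b ^+ 4 = 1 ->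
  exists f : hom GK3 (U5 R), f gx1 = a /\ f gy = b.
Proof.
by move/(GK3_class4_hom (@gamma5_U5 R)) => [f [f1 f_y _]]; exists f.
Qed.

Lemma U5_eqP (R : Type) (a b : U5 R) :
    [/\ e12 a = e12 b, e23 a = e23 b, e34 a = e34 b & e45 a = e45 b] ->
    [/\ e13 a = e13 b, e24 a = e24 b & e35 a = e35 b] ->
  e14 a = e14 b /\ e25 a = e25 b -> e15 a = e15 b -> a = b.
Proof.
by case: a b => [? ? ? ? ? ? ? ? ? ?] [? ? ? ? ? ? ? ? ? ?] /=
  [-> -> -> ->] [-> -> ->] [-> ->] ->.
Qed.

(** Taken over ['Z_4], this shows that p survives while its fourth power dies. *)
Lemma U5_obstruction (R : comNzRingType) :
  obstruction (U5_diag 1 1 1 0 : U5 R)%R (U5_diag 0 0 0 1)%R =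
  (MkU5 0 0 0 0 0 0 0 0 0 1)%R.
Proof. by apply: U5_eqP => /=; try split; ring. Qed.

Lemma U5_obstruction4 (R : comNzRingType) :
  obstruction (U5_diag 1 1 1 0 : U5 R)%R (U5_diag 0 0 0 1)%R ^+ 4 =
  (MkU5 0 0 0 0 0 0 0 0 0 4)%R.
Proof.
rewrite U5_obstruction; apply: U5_eqP => /=; try split; ring.
Qed.

(** * The fourth lower central factor and the quotient by the fifth term *)

Local Notation g4 := (lower_central GK3 4).
Local Notation g5 := (lower_central GK3 5).

(** An element with exponents i, j, k on [c, x, x], [c, x, y], [c, y, y] is sent to (i + j, k, i mod
    4). *)
Lemma GK3_gamma4_gamma5 :
  isomorphic (sub_quot (lower_central GK3 4) (lower_central GK3 5))
    (cyc_inf * cyc_inf * cyc 4)%type.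
Proof.
(* The corner entry of fa contracts with the linear forms X*, X*, X* - Y* and
   Y*, so that it vanishes on p. *)
pose ax : U5 int := (U5_diag 1 1 1 0)%R; pose ay : U5 int := (U5_diag 0 0 (-1) 1)%R.
pose bx : U5 int := (U5_diag 1 0 0 0)%R; pose b_y : U5 int := (U5_diag 0 1 1 1)%R.
pose cx : U5 'Z_4 := (U5_diag 1 1 1 0)%R; pose cy : U5 'Z_4 := (U5_diag 0 0 0 1)%R.
have [|fa [fax fay]] := @U5_class4_hom _ ax ay; first by vm_compute.
(* The corner entry of [fb] reads XYYY and also vanishes on p. That of [fc] reads XXXY and is 1 on
   p, so p^4 dies there because 4 = 0 in ['Z_4]. *)
have [|fb [fbx fby]] := @U5_class4_hom _ bx b_y; first by vm_compute.
have [|fc [fcx fcy]] := @U5_class4_hom _ cx cy.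
  by rewrite U5_obstruction4; congr MkU5; exact: val_inj.
pose T : groupType := (cyc_inf * cyc_inf * cyc 4)%type.
pose t_fun (g : GK3) : T := (e15 (fa g), e15 (fb g), e15 (fc g)).
have tD u v : u \in g4 -> v \in g4 -> t_fun (u * v) = t_fun u * t_fun v.
  move=> gu gv; rewrite /t_fun (U5_pullD fa (e15_character _) gu gv).
  rewrite (U5_pullD fb (e15_character _) gu gv).
  by rewrite (U5_pullD fc (e15_character _) gu gv).
have t0 u : u \in g5 -> t_fun u = 1.
  move=> gu; rewrite /t_fun (U5_pull0 fa (e15_character _) gu).
  rewrite (U5_pull0 fb (e15_character _) gu).
  by rewrite (U5_pull0 fc (e15_character _) gu).
pose t (u : subgroup_type g4) : T := t_fun (val u).
have tM : monoid.monoid_morphism t.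
  split=> [|u v]; first by rewrite /t val1 t0 // gpred1.
  by rewrite /t valM tD ?(valP u) ?(valP v).
pose t' : hom (subgroup_type g4) T := HB.pack t (isUMagmaMorphism.Build _ _ t tM).
have t'0 u : u \in @restrict GK3 g4 g5 -> t' u = 1 by move=> /t0.
pose F : hom (sub_quot g4 g5) T := quot_lift t'0.
have FE u : F (quot_proj _ u) = t u by exact: quot_liftE.
pose c := [~ gx1, gy].
have [gxx gxy gyy] : [/\ [~ c, gx1, gx1] \in g4, [~ c, gx1, gy] \in g4
    & [~ c, gy, gy] \in g4] by split; do 3!apply: gammaR.
have [axx axy ayy] : [/\ e15 (fa [~ c, gx1, gx1]) = 1%R,
    e15 (fa [~ c, gx1, gy]) = 1%R & e15 (fa [~ c, gy, gy]) = 0%R].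
  by rewrite /c !gmulfR fax fay; vm_compute.
have [bxx bxy byy] : [/\ e15 (fb [~ c, gx1, gx1]) = 0%R,
    e15 (fb [~ c, gx1, gy]) = 0%R & e15 (fb [~ c, gy, gy]) = 1%R].
  by rewrite /c !gmulfR fbx fby; vm_compute.
have [cxx cxy cyy] : [/\ e15 (fc [~ c, gx1, gx1]) = 1%R,
    e15 (fc [~ c, gx1, gy]) = 0%R & e15 (fc [~ c, gy, gy]) = 0%R].
  by rewrite /c !gmulfR fcx fcy /=; split; ring.
have coord g i j k :
    (expgz [~ c, gx1, gx1] i * expgz [~ c, gx1, gy] j * expgz [~ c, gy, gy] k)^-1
      * g \in g5 -> t_fun g = (i + j, k, i%:~R)%R.
  move=> gE; rewrite /t_fun (U5_coord fa (e15_character _) gxx gxy gyy gE).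
  rewrite (U5_coord fb (e15_character _) gxx gxy gyy gE).
  rewrite (U5_coord fc (e15_character _) gxx gxy gyy gE).
  rewrite axx axy ayy bxx bxy byy cxx cxy cyy !mul0rz !intz.
  by rewrite !addr0 !add0r.
exists F; apply: bij_surj.
  apply: gmulf_inj; elim/quot_ind=> u; rewrite FE /t => u0.
  apply/quot_proj_eq1; change (val u \in g5).
  have [i [j [k gE]]] := gamma4_coord GK3_span (valP u).
  have [ij k0 i0] : [/\ (i + j = 0)%R, k = 0%R & (i%:~R = 0 :> 'Z_4)%R].
    by have := coord _ _ _ _ gE; rewrite u0 => -[<- <- <-].
  have [m im] : exists m, i = (m * 4%:Z)%R.
    exists (i %/ 4)%Z; rewrite [LHS](divz_eq i 4).
    have [r rE] : exists r : nat, (i %% 4)%Z = r by exists `|(i %% 4)%Z|%N; lia.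
    move: i0; rewrite {1}(divz_eq i 4) rE intrD intrM.
    have -> : (4%:~R = 0 :> 'Z_4)%R by exact: val_inj.
    rewrite mulr0 add0r -pmulrn => /(congr1 (@nat_of_ord _)).
    by rewrite val_Zp_nat //= => r0; lia.
  move: gE; rewrite k0 [expgz _ 0]expg0 mulg1 (_ : j = (- i)%R) ?im; last by lia.
  (* What remains is p^(4 m) modulo the fifth term, killed by [GK3_obstruction]. *)
  suff A5 : expgz [~ c, gx1, gx1] (m * 4%:Z)%R *
      expgz [~ c, gx1, gy] (- (m * 4%:Z))%R \in g5.
    by move=> gE; have := gpredM _ _ A5 gE; rewrite mulVKg.
  pose q : hom GK3 (quot g5) := quot_proj _.
  have qc : commute (q [~ c, gx1, gx1]) (q [~ c, gx1, gy])^-1.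
    by apply/commuteV/commgP/eqP; rewrite -gmulfR; apply/quot_proj_eq1/gammaR.
  have o4 : q (obstruction gx1 gy) ^+ 4 = 1.
    by rewrite -gmulfXn; apply/quot_proj_eq1/GK3_obstruction.
  apply/quot_proj_eq1; rewrite -/q gmulfM !gmulf_expgz -expgzV -expgzMl // expgzM.
  by rewrite -gmulfF o4 expgz1.
move=> [[a b] d].
(* The exponent i lifts d, and j = a - i then restores the first coordinate. *)
pose n : int := Posz (d : 'Z_4).
pose g := expgz [~ c, gx1, gx1] n * expgz [~ c, gx1, gy] (a - n)%R
  * expgz [~ c, gy, gy] b.
have gg : g \in g4 by rewrite !gpredM ?gpred_expgz.
exists (quot_proj _ (Subgroup gg)); rewrite FE /t /=.
rewrite (coord g n (a - n)%R b) ?mulVg ?gpred1 //.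
congr (_, _, _); first by rewrite addrC subrK.
exact: natr_Zp.
Qed.

(** Torsion in the fourth term separates the two quotients: p has a trivial fourth power in that of
    [GK3], without being trivial, whereas the fourth factor of [F2] is torsion-free. *)
Lemma GK3_mod_gamma5 :
  ~ isomorphic (quot (lower_central GK3 5)) (quot (lower_central F2 5)).
Proof.
case=> f0 [h fK hK].
have fM : monoid.monoid_morphism f0.
  by split; [apply: (mulgI (f0 1)); rewrite -gmulfM !mulg1 | exact: gmulfM].
pose f : hom _ _ := HB.pack (f0 : _ -> _) (isUMagmaMorphism.Build _ _ _ fM).
pose q : hom GK3 (quot (lower_central GK3 5)) := quot_proj _.
pose p : hom F2 (quot (lower_central F2 5)) := quot_proj _.
pose o := obstruction gx1 gy.
have o4 : q o ^+ 4 = 1.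
  by rewrite -gmulfXn; apply/quot_proj_eq1/GK3_obstruction.
have fo : f (q o) \in lower_central _ 4.
  by apply/gamma_hom/gamma_hom/obstruction_gamma4.
have [w w4 pw] : exists2 w, w \in lower_central F2 4 & p w = f (q o).
  by apply: gamma_surj fo => z; exists (repr z); exact: quot_reprK.
have w5 : w \in lower_central F2 5.
  apply: (F2_gamma4_torsion_free (m := 4)) => //.
  by apply/quot_proj_eq1; rewrite -/p gmulfXn pw -gmulfXn o4 gmulf1.
have fo1 : f (q o) = 1 by rewrite -pw; apply/quot_proj_eq1.
have qo1 : q o = 1 by apply: (can_inj fK); rewrite [LHS]fo1 fM.1.
have o5 : o \in lower_central GK3 5 by apply/quot_proj_eq1.
(* This representation sends p to a matrix with corner entry 1, a contradiction. *)
have [|r [rx ry]] := @U5_class4_hom 'Z_4 (U5_diag 1 1 1 0)%R (U5_diag 0 0 0 1)%R.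
  by rewrite U5_obstruction4; congr MkU5; exact: val_inj.
have := gamma5_U5 (gamma_hom r o5).
rewrite gmulf_obstruction rx ry U5_obstruction => /(congr1 (@e15 _)).
by [].
Qed.

Theorem theorem4p6 :
  (isomorphic (quot (normal_closure [set gy ^+ 2])) (free_product Gxz (cyc 2)) /\
   exists H : groupClosed (quot (normal_closure [set gy ^+ 2])),
     isomorphic (subgroup_type H) (free_product (cyc 3) (cyc 2))) /\
  (isomorphic (quot (lower_central GK3 4)) (quot (lower_central F2 4)) /\
   isomorphic (sub_quot (lower_central GK3 4) (lower_central GK3 5))
     (cyc_inf * cyc_inf * cyc 4)%type /\
   ~ isomorphic (quot (lower_central GK3 5)) (quot (lower_central F2 5))).
Proof.
split; first by split; [exact: Ky2_isomorphic | exact: Ky2_subgroup].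
split; first exact: GK3_mod_gamma4.
by split; [exact: GK3_gamma4_gamma5 | exact: GK3_mod_gamma5].
Qed.
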